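(* For every integer $g\ge1$, the inflation complex $I^{(g)}_\bullet$ is acyclic, i.e. $H_n(I^{(g)}_\bullet)=0$ for all $n$.
   Context: Perfect cones. Identify quadratic forms on $\mathbb{R}^g$ with symmetric real $g\times g$ matrices. $\Omega_g$ is the cone of positive definite forms and $\Omega_g^{\mathrm{rt}}$ the set of positive semidefinite forms whose kernel is defined over $\mathbb{Q}$. $h\in\mathrm{GL}_g(\mathbb{Z})$ acts by $Q\mapsto hQh^t$. For $Q\in\Omega_g$ let $M(Q)$ be the set of nonzero vectors of $\mathbb{Z}^g$ at which $Q$ attains its minimum on $\mathbb{Z}^g\setminus\{0\}$, and $\sigma[Q]=\mathbb{R}_{\ge0}\langle \xi\xi^t:\xi\in M(Q)\rangle$. $\Sigma_g^{\mathrm P}$ is the set of all cones $\sigma[Q]$, $Q\in\Omega_g$, together with $\{0\}$; its elements are called perfect cones. It is a $\mathrm{GL}_g(\mathbb{Z})$-invariant collection of rational polyhedral cones, closed under taking faces, any two meeting along a common face, with finitely many orbits and union $\Omega_g^{\mathrm{rt}}$. The rank of a perfect cone is the maximal rank of an element of it; its dimension is that of its linear span. Orientations. An orientation of a cone is an orientation of its linear span. If $\rho$ is a facet of $\sigma$ and $\omega_\sigma$ an orientation of $\sigma$, the induced orientation $\omega_\sigma|_\rho$ is represented by an ordered basis $(v_1,\dots,v_n)$ of $\mathbb{R}\rho$ such that $(v_1,\dots,v_n,v)$ is positive for $\omega_\sigma$, where $v$ is a generator of any ray of $\sigma$ not in $\rho$. A cone $\sigma\in\Sigma_g^{\mathrm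 P}$ is alternating if every element of $\mathrm{GL}_g(\mathbb{Z})$ stabilizing $\sigma$ acts on it preserving orientation. Perfect chain complex. For each $n$ let $\Gamma_n$ be a set of representatives of the $\mathrm{GL}_g(\mathbb{Z})$-orbits of alternating cones of dimension $n+1$ in $\Sigma_g^{\mathrm P}$. Choose orientations $\omega_\sigma$ for $\sigma\in\Gamma_n$, and extend them to all alternating cones by the $\mathrm{GL}_g(\mathbb{Z})$-action. For $\sigma\in\Gamma_n$, $\sigma'\in\Gamma_{n-1}$ set $\delta(\sigma',\sigma)=\sum_\rho\eta(\rho,\sigma)$, the sum over facets $\rho$ of $\sigma$ in the $\mathrm{GL}_g(\mathbb{Z})$-orbit of $\sigma'$, with $\eta(\rho,\sigma)=1$ if $\omega_\rho=\omega_\sigma|_\rho$ and $-1$ otherwise. $P^{(g)}_n$ is the $\mathbb{Q}$-vector space with basis $\{e_\sigma:\sigma\in\Gamma_n\}$, and $\partial e_\sigma=\sum_{\sigma'\in\Gamma_{n-1}}\delta(\sigma',\sigma)e_{\sigma'}$. Coloops. For a finite set $S\subset\mathbb{Z}^g$, $v\in S$ is a $\mathbb{Z}^g$-coloop of $S$ if $v$ is part of a $\mathbb{Z}$-basis $v,w_2,\dots,w_g$ of $\mathbb{Z}^g$ such that every $w\in S\setminus\{v\}$ lies in the $\mathbb{Z}$-span of $w_2,\dots,w_g$. For $\sigma=\sigma[Q]$, let $M'(Q)$ consist of a choice of one of $\{v,-v\}$ for each $v\in M(Q)$; a coloop of $\sigma$ is a $\mathbb{Z}^g$-coloop of $M'(Q)$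 (the zero cone has no coloops). Inflation complex. $I^{(g)}_\bullet$ is the subcomplex of $P^{(g)}_\bullet$ spanned in degree $n$ by the $e_\sigma$ with $\sigma\in\Gamma_n$ such that either $\sigma$ has rank $\le g-1$, or $\sigma$ has rank $g$ and has a coloop. *)

(* Defs.v *)
From HB Require Import structures.
From mathcomp Require Import all_boot all_order all_algebra.
From mathcomp Require Import boolp classical_sets functions cardinality fsbigop.
From mathcomp Require Import reals.

Set Implicit Arguments.
Unset Strict Implicit.
Unset Printing Implicit Defensive.

Import Order.TTheory GRing.Theory Num.Theory.
Local Open Scope classical_set_scope.
Local Open Scope ring_scope.

(** * Linear spans and orientations *)

Definition lspan (F : fieldType) (V : vectType F) (A : set V) : {vspace V} :=
  xget 0%VS [set U : {vspace V} | (forall x, A x -> x \in U) /\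
                     (forall W : {vspace V}, (forall x, A x -> x \in W) ->
                        (U <= W)%VS)].

Lemma lspanP (F : fieldType) (V : vectType F) (A : set V) :
  (forall x, A x -> x \in lspan A) /\
  (forall W : {vspace V}, (forall x, A x -> x \in W) -> (lspan A <= W)%VS).
Proof.
suff ex : exists U : {vspace V}, (forall x, A x -> x \in U) /\
    (forall W : {vspace V}, (forall x, A x -> x \in W) -> (U <= W)%VS).
  exact: (xgetPex 0%VS ex).
pose P k := `[< exists2 U : {vspace V}, (forall x, A x -> x \in U)
                                        & \dim U = k >].
have exP : exists k, P k.
  exists (\dim {:V}); apply/asboolP; exists fullv => // x _; exact: memvf.
case: (ex_minnP exP) => m /asboolP[U AU dU] min_m; exists U; split=> // W AW.
apply/capv_idPl/eqP; rewrite eqEdim capvSl dU /=; apply: min_m.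
by apply/asboolP; exists (U :&: W)%VS => // x Ax; rewrite memv_cap AU ?AW.
Qed.

(* The sign of the determinant of the change of basis from [b] to [c]. *)
Definition same_orientation (F : realFieldType) (V : vectType F)
    (b c : seq V) : bool :=
  0 < \det (\matrix_(i < size b, j < size b) coord (in_tuple b) j c`_i).

(* An orientation is encoded as the set of its positive ordered bases.  When
   [\dim U > 0] there are two such sets, the two classes of ordered bases.  When
   [U = 0] the only basis is [[::]] and the two orientations are [[set [::]]]
   and [set0]. *)
Definition is_orientation (F : realFieldType) (V : vectType F)
    (U : {vspace V}) (o : set (seq V)) : Prop :=
  (forall b, o b -> basis_of U b) /\
  (forall b c, basis_of U b -> basis_of U c ->
     ((o b <-> o c) <-> same_orientation b c)).

(** * Quadratic forms, perfect cones and the action of GL_g(Z) *)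

Definition intvec (R : realType) (g : nat) (v : 'cV[int]_g) : 'cV[R]_g :=
  map_mx intr v.

Definition qval (R : realType) (g : nat) (Q : 'M[R]_g) (x : 'cV[R]_g) : R :=
  (x^T *m Q *m x) 0 0.

Definition posdef (R : realType) (g : nat) (Q : 'M[R]_g) : Prop :=
  Q^T = Q /\ forall x : 'cV[R]_g, x != 0 -> 0 < qval Q x.

Definition minvec (R : realType) (g : nat) (Q : 'M[R]_g) : set 'cV[int]_g :=
  [set v | v != 0 /\
     forall w : 'cV[int]_g, w != 0 -> qval Q (intvec R v) <= qval Q (intvec R w)].

Definition sqform (R : realType) (g : nat) (v : 'cV[int]_g) : 'M[R]_g :=
  intvec R v *m (intvec R v)^T.

Definition sigma_cone (R : realType) (g : nat) (Q : 'M[R]_g) : set 'M[R]_g :=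
  [set X | exists (k : nat) (a : 'I_k -> R) (v : 'I_k -> 'cV[int]_g),
     (forall i, 0 <= a i /\ minvec Q (v i)) /\
     X = \sum_(i < k) a i *: sqform R (v i)].

Definition perfect_cone (R : realType) (g : nat) (s : set 'M[R]_g) : Prop :=
  s = [set 0] \/ exists2 Q : 'M[R]_g, posdef Q & s = sigma_cone Q.

Definition glact (R : realType) (g : nat) (h : 'M[int]_g) (X : 'M[R]_g) :
    'M[R]_g :=
  map_mx intr h *m X *m (map_mx intr h)^T.

(* GL_g(Z) is the set of [h : 'M[int]_g] with [h \in unitmx]. *)
Definition same_orbit (R : realType) (g : nat) (s t : set 'M[R]_g) : Prop :=
  exists2 h : 'M[int]_g, h \in unitmx & t = [set glact h X | X in s].

Definition orient_act (R : realType) (g : nat) (h : 'M[int]_g)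
    (o : set (seq 'M[R]_g)) : set (seq 'M[R]_g) :=
  [set map (glact h) b | b in o].

Definition cone_dim (R : realType) (g : nat) (s : set 'M[R]_g) : nat :=
  \dim (lspan s).

Definition cone_rank (R : realType) (g : nat) (s : set 'M[R]_g) : nat :=
  \max_(r < g.+1 | `[< exists2 X, s X & \rank X = r >]) r.

Definition is_face (R : realType) (g : nat) (f s : set 'M[R]_g) : Prop :=
  exists l : {scalar 'M[R]_g},
    (forall X, s X -> 0 <= l X) /\ f = [set X | s X /\ l X = 0].

Definition is_facet (R : realType) (g : nat) (f s : set 'M[R]_g) : Prop :=
  is_face f s /\ (cone_dim f).+1 = cone_dim s.

Definition ray_generator (R : realType) (g : nat) (s : set 'M[R]_g)
    (v : 'M[R]_g) : Prop :=
  exists f, [/\ is_face f s, cone_dim f = 1%N, f v & v != 0].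

Definition induced_orientation (R : realType) (g : nat) (f s : set 'M[R]_g)
    (o : set (seq 'M[R]_g)) : set (seq 'M[R]_g) :=
  [set b | basis_of (lspan f) b /\
     exists v, [/\ ray_generator s v, ~ f v & o (rcons b v)]].

Definition alternating (R : realType) (g : nat) (s : set 'M[R]_g) : Prop :=
  perfect_cone s /\
  forall h : 'M[int]_g, h \in unitmx -> [set glact h X | X in s] = s ->
    forall o, is_orientation (lspan s) o -> orient_act h o = o.

(** * The perfect chain complex *)

(* Homological degree [n] corresponds to dimension [n + 1]; the zero cone, which
   is alternating, sits in degree -1. *)
Definition alternating_of_degree (R : realType) (g : nat) (n : int) :
    set (set 'M[R]_g) :=
  [set s | alternating s /\ (cone_dim s)%:Z = n + 1].

Definition orbit_representatives (R : realType) (g : nat)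
    (A G : set (set 'M[R]_g)) : Prop :=
  G `<=` A /\ forall s, A s -> exists! t, G t /\ same_orbit t s.

(* [G n] is the set of representatives in degree [n], and [om] the chosen
   orientations of the representatives; this extends [om] by the action. *)
Definition extend_orientation (R : realType) (g : nat)
    (G : int -> set (set 'M[R]_g)) (om : set 'M[R]_g -> set (seq 'M[R]_g))
    (s : set 'M[R]_g) : set (seq 'M[R]_g) :=
  [set b | exists n t (h : 'M[int]_g),
     [/\ G n t, h \in unitmx, s = [set glact h X | X in t]
       & orient_act h (om t) b]].

Definition eta (R : realType) (g : nat)
    (G : int -> set (set 'M[R]_g)) (om : set 'M[R]_g -> set (seq 'M[R]_g))
    (f s : set 'M[R]_g) : rat :=
  if `[< extend_orientation G om f = induced_orientation f s (om s) >]
  then 1 else -1.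

(* [\sum_(f \in A)] is 0 by convention when its support is infinite; here the index
   set is finite, since a perfect cone is polyhedral. *)
Definition delta (R : realType) (g : nat)
    (G : int -> set (set 'M[R]_g)) (om : set 'M[R]_g -> set (seq 'M[R]_g))
    (s' s : set 'M[R]_g) : rat :=
  \sum_(f \in [set f | is_facet f s /\ same_orbit s' f]) eta G om f s.

(* [perfect_chains G n] is the space with basis [G n]: a chain is given by its
   coefficients, which vanish outside a finite subset of [G n]. *)
Definition perfect_chains (R : realType) (g : nat)
    (G : int -> set (set 'M[R]_g)) (n : int) : set (set 'M[R]_g -> rat) :=
  [set c | finite_set [set s | c s != 0] /\ [set s | c s != 0] `<=` G n].

Definition boundary (R : realType) (g : nat)
    (G : int -> set (set 'M[R]_g)) (om : set 'M[R]_g -> set (seq 'M[R]_g))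
    (n : int) (c : set 'M[R]_g -> rat) : set 'M[R]_g -> rat :=
  fun s' => if `[< G (n - 1) s' >]
            then \sum_(s \in G n) c s * delta G om s' s else 0.

(** * Coloops and the inflation complex *)

Definition Zbasis (g : nat) (w : 'I_g -> 'cV[int]_g) : Prop :=
  forall x, exists! a : {ffun 'I_g -> int}, x = \sum_i a i *: w i.

Definition Zcoloop (g : nat) (S : set 'cV[int]_g) (v : 'cV[int]_g) : Prop :=
  S v /\ exists (w : 'I_g -> 'cV[int]_g) (k : 'I_g),
    [/\ Zbasis w, w k = v &
        forall x, S x -> x <> v ->
          exists a : 'I_g -> int, x = \sum_(i | i != k) a i *: w i].

(* [S] contains exactly one of [v], [- v] for each minimal vector [v]. *)
Definition half_minvec (R : realType) (g : nat) (Q : 'M[R]_g)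
    (S : set 'cV[int]_g) : Prop :=
  S `<=` minvec Q /\ forall v, minvec Q v -> (S v <-> ~ S (- v)).

(* Whether [S] has a coloop depends neither on the choice of signs nor on the
   choice of [Q]: up to sign, the minimal vectors of [Q] are the primitive
   integral vectors [v] such that [v v^T] spans a ray of [sigma_cone Q]. *)
Definition has_coloop (R : realType) (g : nat) (s : set 'M[R]_g) : Prop :=
  exists (Q : 'M[R]_g) (S : set 'cV[int]_g) (v : 'cV[int]_g),
    [/\ posdef Q, s = sigma_cone Q, half_minvec Q S & Zcoloop S v].

Definition inflation_cone (R : realType) (g : nat) (s : set 'M[R]_g) : Prop :=
  (cone_rank s <= g - 1)%N \/ (cone_rank s = g /\ has_coloop s).

Definition inflation_chains (R : realType) (g : nat)
    (G : int -> set (set 'M[R]_g)) (n : int) : set (set 'M[R]_g -> rat) :=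
  [set c | perfect_chains G n c /\ forall s, c s != 0 -> inflation_cone s].

(* Main.v *)
Require Import Defs.
From HB Require Import structures.
From mathcomp Require Import all_boot all_order all_algebra.
From mathcomp Require Import boolp classical_sets functions cardinality fsbigop.
From mathcomp Require Import reals.
From mathcomp Require Import perm ring lra zify.
Set Implicit Arguments.
Unset Strict Implicit.
Unset Printing Implicit Defensive.
Import Order.TTheory GRing.Theory Num.Theory.
Local Open Scope classical_set_scope.
Local Open Scope ring_scope.

(* A perfect cone s = sigma[Q] of rank < g lies in Sym^2 of a hyperplane summand
   ker phi of Z^g; choosing v with phi(v) = 1, its inflation s + R_{>=0} v v^T is
   again perfect (it is sigma of Q o pi + m phi^2, with pi the projection along v
   and m the minimum of Q), does not depend on v up to GL_g(Z), and its facets are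
   s itself and the inflations of the facets of s.  Dually, on cochains (functions
   F(s, b) of a cone and an ordered basis of its span that are alternating in b
   and invariant under GL_g(Z)) put (I F)(s, b) = F(infl s, b v v^T) if
   rank s < g, and (I F)(s, b) = 0 otherwise.  The description of the facets gives
   I d + d I = 1 on all cones of the inflation complex: the term of s in d F on
   infl s is F(s), the other terms cancel because two vectors are exchanged, and
   F vanishes on a cone with two coloops since swapping them reverses its
   orientation.  Transposing, chains are contractible.  The relation d d = 0 comes
   from the diamond property of polyhedral cones; facets that are perfect but not
   alternating contribute 0 because cochains vanish on them. *)

(** * Orientations *)

(** A formula on chains would have to carry each facet and each inflation back to its orbit
    representative and record the sign of that move. Cochains on all perfect cones and all ordered
    bases avoid this: [G] and [om] enter only through the dual basis cochains [orb x] and the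
    evaluations [ev F s], and every sign compares two ordered bases of one span. Two points carry
    the weight. Inflation has to be well defined on pairs (s, b), so the element of GL_g(Z) that
    moves one complement v to another must fix all minimal vectors of s, hence s and b pointwise
    ([splits_conj]). And the minimal vectors must be determined by the cone, not by the form Q that
    presents it ([pres_uniq]). The two kinds of inflation cones become a single condition,
    [coloop_cone]: for some phi and v with phi(v) = 1, every minimal vector lies in ker phi or is v
    or -v. The zero cone, in degree -1, is one of them because g >= 1; it cancels against the ray
    that is its inflation. *)

Section BaseChange.
Variables (F : realFieldType) (V : vectType F).
Implicit Types (b c : seq V) (U : {vspace V}).

(** The dimension [n] is kept apart from [size b], so that composites and block matrices have
    matching types without casts. *)
Definition base_change n b c (A : 'M[F]_n) : Prop :=
  [/\ size b = n, size c = n &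
      forall i : 'I_n, c`_i = \sum_(j < n) A i j *: b`_j].

Lemma same_orientation_det n b c (A : 'M[F]_n) :
  free b -> base_change b c A -> same_orientation b c = (0 < \det A).
Proof.
move=> fb [sb sc Ac]; subst n; rewrite /same_orientation; congr (0 < \det _).
apply/matrixP=> i j; rewrite mxE Ac.
have -> : \sum_(j0 < size b) A i j0 *: b`_j0 =
          \sum_(j0 < size b) A i j0 *: (in_tuple b)`_j0 by [].
by rewrite coord_sum_free.
Qed.

Lemma base_change_uniq n b c (A B : 'M[F]_n) :
  free b -> base_change b c A -> base_change b c B -> A = B.
Proof.
move=> fb [sb _ Ac] [_ _ Bc]; subst n; apply/matrixP=> i j.
have := Ac i; rewrite Bc => /(congr1 (coord (in_tuple b) j)).
have cs (k : 'I_(size b) -> F) :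
  coord (in_tuple b) j (\sum_(j0 < size b) k j0 *: b`_j0) = k j.
  exact: (@coord_sum_free _ _ _ (in_tuple b) k j fb).
by rewrite (cs (B i)) (cs (A i)).
Qed.

Lemma base_changeM n a b c (A B : 'M[F]_n) :
  base_change a b A -> base_change b c B -> base_change a c (B *m A).
Proof.
move=> [sa sb bE] [_ sc cE]; split=> // i; rewrite cE.
under eq_bigr do rewrite bE scaler_sumr.
rewrite exchange_big /=; apply: eq_bigr => j _; rewrite mxE scaler_suml.
by apply: eq_bigr => k _; rewrite scalerA.
Qed.

Lemma base_change1 b : base_change b b (1%:M : 'M[F]_(size b)).
Proof.
split=> // i; rewrite (bigD1 i) //= mxE eqxx scale1r big1 ?addr0 // => j ji.
by rewrite mxE eq_sym (negPf ji) scale0r.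
Qed.

Lemma basis_size U b : basis_of U b -> size b = \dim U.
Proof. by move=> bU; rewrite -(span_basis bU) (eqP (basis_free bU)). Qed.

Lemma base_change_exists U b c :
  basis_of U b -> basis_of U c ->
  exists2 A : 'M[F]_(size b), base_change b c A & A \in unitmx.
Proof.
move=> bU cU.
have sbc : size b = size c by rewrite (basis_size bU) (basis_size cU).
have ex b' c' n : size b' = n -> size c' = n -> basis_of U b' -> basis_of U c' ->
    exists A : 'M[F]_n, base_change b' c' A.
  move=> sb' sc' b'U c'U; subst n.
  exists (\matrix_(i, j) coord (in_tuple b') j c'`_i); split=> // i.
  have cU' : c'`_i \in U by apply: (basis_mem c'U); rewrite mem_nth // sc'.
  rewrite (coord_basis (X := in_tuple b') b'U cU').
  by apply: eq_bigr => j _; rewrite mxE.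
have [A bA] := ex b c (size b) erefl (esym sbc) bU cU.
have [B cB] := ex c b (size b) (esym sbc) erefl cU bU.
exists A => //.
(* Going to [c] and back is a change from [b] to itself, hence the identity by uniqueness; this
   makes [A] invertible. *)
have := base_change_uniq (basis_free bU) (base_changeM bA cB) (base_change1 b).
by move=> /mulmx1_unit[].
Qed.

Lemma same_orientation_refl b : free b -> same_orientation b b.
Proof. by move=> fb; rewrite (same_orientation_det fb (base_change1 b)) det1 ltr01. Qed.

Lemma same_orientation_trans U a b c :
  basis_of U a -> basis_of U b -> basis_of U c ->
  same_orientation a c = (same_orientation a b == same_orientation b c).
Proof.
move=> aU bU cU.
have [A bA uA] := base_change_exists aU bU.
have [B cB uB] := base_change_exists bU cU.
have sab : size a = size b by rewrite (basis_size aU) (basis_size bU).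
move: B cB uB; rewrite -sab => B cB uB.
rewrite (same_orientation_det (basis_free aU) (base_changeM bA cB)).
rewrite (same_orientation_det (basis_free aU) bA).
rewrite (same_orientation_det (basis_free bU) cB).
rewrite det_mulmx; move: uA uB; rewrite !unitmxE !unitfE.
case: (ltrgt0P (\det A)) => // hA _; case: (ltrgt0P (\det B)) => // hB _.
- by rewrite mulr_gt0.
- by rewrite pmulr_lgt0 // lt_gtF.
- by rewrite pmulr_rgt0 // lt_gtF.
- by rewrite nmulr_rgt0 // hA.
Qed.

Lemma same_orientation_sym U b c : basis_of U b -> basis_of U c ->
  same_orientation b c = same_orientation c b.
Proof.
move=> bU cU; have := same_orientation_trans bU cU bU.
by rewrite same_orientation_refl ?(basis_free bU) // => /esym/eqP.
Qed.

Lemma sum_nth_rcons n b x (u : 'I_(n + 1) -> F) : size b = n ->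
  \sum_(j < n + 1) u j *: (rcons b x)`_j =
  (\sum_(j < n) u (lshift 1 j) *: b`_j) + u (rshift n ord0) *: x.
Proof.
move=> sb; rewrite big_split_ord /= big_ord1; congr (_ + _).
  by apply: eq_bigr => j _; rewrite nth_rcons /= sb ltn_ord.
by rewrite nth_rcons /= sb addn0 ltnn eqxx.
Qed.

Lemma base_change_rcons n b c x y (A : 'M[F]_n) (u : 'rV[F]_n) t :
  base_change b c A -> y = \sum_(j < n) u 0 j *: b`_j + t *: x ->
  base_change (rcons b x) (rcons c y) (block_mx A 0 u (t%:M : 'M_1)).
Proof.
move=> [sb sc cE] yE; split; rewrite ?size_rcons ?sb ?sc ?addn1 //.
move=> i; rewrite sum_nth_rcons //; case: (splitP i) => k ik.
  have -> : i = lshift 1 k by apply: val_inj.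
  rewrite nth_rcons /= sc ltn_ord cE block_mxEur mxE scale0r addr0.
  by apply: eq_bigr => j _; rewrite block_mxEul.
have -> : i = rshift n ord0 by apply: val_inj; rewrite /= ik ord1.
rewrite nth_rcons /= sc addn0 ltnn eqxx yE block_mxEdr mxE eqxx.
by congr (_ + _); apply: eq_bigr => j _; rewrite block_mxEdl.
Qed.

(** Modulo [U] the vector [y] is [t] times [x], so the change of basis is block triangular with last
    diagonal entry [t > 0]. This makes the orientation induced on a facet independent of the added
    vector. *)
Lemma same_orientation_rcons U b c x y (t : F) :
  free (rcons b x) -> basis_of U b -> basis_of U c -> y - t *: x \in U -> 0 < t ->
  same_orientation (rcons b x) (rcons c y) = same_orientation b c.
Proof.
move=> fbx bU cU yx t0.
have [A bA uA] := base_change_exists bU cU.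
have yE : y = \sum_(j < size b) coord (in_tuple b) j (y - t *: x) *: b`_j + t *: x.
  by rewrite -(coord_basis (X := in_tuple b) bU yx) subrK.
have bx : base_change (rcons b x) (rcons c y)
  (block_mx A 0 (\row_j coord (in_tuple b) j (y - t *: x)) (t%:M : 'M_1)).
  apply: base_change_rcons => //; rewrite {1}yE; congr (_ + _).
  by apply: eq_bigr => j _; rewrite mxE.
rewrite (same_orientation_det fbx bx) (same_orientation_det (basis_free bU) bA).
by rewrite det_lblock det_scalar1 pmulr_lgt0.
Qed.

(** The change of basis is the permutation matrix of a transposition. The cancellations in d d = 0,
    in the homotopy and for two coloops all come from this sign. *)
Lemma same_orientation_swap b x y : free (rcons (rcons b x) y) ->
  same_orientation (rcons (rcons b x) y) (rcons (rcons b y) x) = false.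
Proof.
move=> fb; pose n := size b.
pose i : 'I_n.+2 := Ordinal (ltnW (ltnSn n.+1)); pose j : 'I_n.+2 := ord_max.
have bc : base_change (rcons (rcons b x) y) (rcons (rcons b y) x)
    (perm_mx (tperm i j) : 'M[F]_n.+2).
  split; rewrite ?size_rcons // => k.
  rewrite (bigD1 (tperm i j k)) //= big1 ?addr0; last first.
    by move=> l lk; rewrite !mxE eq_sym (negPf lk) scale0r.
  rewrite !mxE eqxx scale1r.
  case: tpermP => [->|->|ki kj]; rewrite !nth_rcons !size_rcons /= -/n.
  - by rewrite ltnS leqnn ltnn eqxx ltnn eqxx.
  - by rewrite ltnn eqxx ltnS leqnn ltnn eqxx.
  - have kn : (k < n)%N.
      have : (k < n.+2)%N by [].
      rewrite ltnS leq_eqVlt => /orP[/eqP kn1|].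
        by case: kj; apply: val_inj.
      rewrite ltnS leq_eqVlt => /orP[/eqP kn|//].
      by case: ki; apply: val_inj.
    by rewrite (leqW kn) kn.
rewrite (same_orientation_det fb bc) det_perm odd_tperm.
by rewrite -val_eqE /= -/n neq_ltn ltnSn /= expr1 ltr0N1.
Qed.

End BaseChange.

Lemma free_map_inj (F : fieldType) (V W : vectType F) (f : {linear V -> W})
  (b : seq V) : injective f -> free b -> free (map f b).
Proof.
move=> fI fb; apply/(@freeP _ _ _ (map_tuple f (in_tuple b))) => k.
under eq_bigr do rewrite (nth_map 0) //.
rewrite -[X in X = 0](_ : f (\sum_(i < size b) k i *: b`_i) = _); last first.
  by rewrite linear_sum; apply: eq_bigr => i _; rewrite linearZ.
move=> /eqP; rewrite -(linear0 f) => /eqP/fI.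
by move: fb => /(@freeP _ _ _ (in_tuple b)); exact.
Qed.

Lemma same_orientation_map (F : realFieldType) (V W : vectType F)
    (f : {linear V -> W}) (U : {vspace V}) (b c : seq V) :
  injective f -> basis_of U b -> basis_of U c ->
  same_orientation (map f b) (map f c) = same_orientation b c.
Proof.
move=> fI bU cU; have [A bA uA] := base_change_exists bU cU.
rewrite (same_orientation_det (basis_free bU) bA).
apply: same_orientation_det; first exact: free_map_inj (basis_free bU).
case: bA => _ sc bA; split; rewrite ?size_map // => i.
rewrite (nth_map 0) ?sc // bA linear_sum.
by apply: eq_bigr => j _; rewrite linearZ (nth_map 0).
Qed.

(** * Polyhedral cones *)

Lemma scalar_of_fun (F : fieldType) (V : lmodType F) (f : V -> F) :
  (forall a x y, f (a *: x + y) = a * f x + f y) ->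
  exists l : {scalar V}, forall x, l x = f x.
Proof.
move=> fl; pose m := GRing.isLinear.Build F V F *%R f fl.
by pose l : {scalar V} := HB.pack f m; exists l.
Qed.

Section Span.
Variables (F : realFieldType) (V : vectType F).
Implicit Types (A B : set V) (U W : {vspace V}).

Lemma mem_lspan A x : A x -> x \in lspan A.
Proof. by case: (lspanP A) => + _; apply. Qed.

Lemma lspan_subv A W : (forall x, A x -> x \in W) -> (lspan A <= W)%VS.
Proof. by case: (lspanP A) => _; apply. Qed.

Lemma lspanS A B : A `<=` B -> (lspan A <= lspan B)%VS.
Proof. by move=> AB; apply: lspan_subv => x /AB; exact: mem_lspan. Qed.

Lemma lspan_eq (l m : {scalar V}) A x : (forall y, A y -> l y = m y) ->
  x \in lspan A -> l x = m x.
Proof.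
move=> lA; have [d dE] : exists d : {scalar V}, forall x, d x = l x - m x.
  by apply: scalar_of_fun => a y z; rewrite !linearP /=; ring.
pose K := lker (linfun (d : V -> F^o)).
have AK : (lspan A <= K)%VS.
  by apply: lspan_subv => y Ay; rewrite memv_ker lfunE /= dE lA // subrr.
move/(subvP AK); rewrite memv_ker lfunE /= dE => /eqP.
by move/subr0_eq.
Qed.

Lemma lspan_eq0 (l : {scalar V}) A x : (forall y, A y -> l y = 0) ->
  x \in lspan A -> l x = 0.
Proof.
move=> lA; have [z zE] : exists z : {scalar V}, forall x, z x = 0.
  by apply: scalar_of_fun => a y w; rewrite mulr0 addr0.
by move=> /(@lspan_eq l z) ->// y /lA ->; rewrite zE.
Qed.

Lemma basis_rcons U (b : seq V) x : basis_of U b -> x \notin U ->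
  basis_of (U + <[x]>)%VS (rcons b x).
Proof.
move=> bU xU; have eb : perm_eq (rcons b x) (x :: b) by rewrite perm_rcons.
rewrite (perm_basis _ eb) /basis_of span_cons (span_basis bU) addvC eqxx /=.
by rewrite free_cons (span_basis bU) xU (basis_free bU).
Qed.

Lemma dim_addv_line U x : x \notin U -> \dim (U + <[x]>)%VS = (\dim U).+1.
Proof.
move=> xU; have bU := vbasisP U.
by rewrite -(basis_size (basis_rcons bU xU)) size_rcons (basis_size bU).
Qed.

End Span.

Section Cone.
Variables (R : realType) (V : lmodType R).
Implicit Types (X Y : set V) (l : {scalar V}).

Definition cone X : set V :=
  [set x | exists (k : nat) (a : 'I_k -> R) (y : 'I_k -> V),
     (forall i, 0 <= a i /\ X (y i)) /\ x = \sum_(i < k) a i *: y i].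

Lemma cone_gen X x : X x -> cone X x.
Proof.
move=> Xx; exists 1%N, (fun=> 1), (fun=> x); split; first by move=> _; split.
by rewrite big_ord1 scale1r.
Qed.

Lemma cone0 X : cone X 0.
Proof.
exists 0%N, (fun=> 0), (fun=> 0); split; first by case.
by rewrite big_ord0.
Qed.

Lemma coneD X x y : cone X x -> cone X y -> cone X (x + y).
Proof.
move=> [k [a [u [au ->]]]] [m [b [w [bw ->]]]].
exists (k + m)%N,
  (fun i : 'I_(k + m) => match fintype.split i with inl j => a j | inr j => b j end),
  (fun i : 'I_(k + m) => match fintype.split i with inl j => u j | inr j => w j end).
split; first by move=> i; case: (fintype.splitP i) => j _.
rewrite big_split_ord /=; congr (_ + _); apply: eq_bigr => i _.
  by rewrite (fintype.unsplitK (inl i)).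
by rewrite (fintype.unsplitK (inr i)).
Qed.

Lemma coneZ X (t : R) x : 0 <= t -> cone X x -> cone X (t *: x).
Proof.
move=> t0 [k [a [u [au ->]]]]; exists k, (fun i => t * a i), u; split.
  by move=> i; have [? ?] := au i; rewrite mulr_ge0.
by rewrite scaler_sumr; apply: eq_bigr => i _; rewrite scalerA.
Qed.

Lemma cone_min X (P : set V) : P 0 ->
  (forall x y, P x -> P y -> P (x + y)) ->
  (forall t x, 0 <= t -> X x -> P (t *: x)) -> cone X `<=` P.
Proof.
move=> P0 PD PZ x [k [a [u [au ->]]]].
by apply: (big_ind P) => // i _; have [? ?] := au i; exact: PZ.
Qed.

Lemma coneS X Y : X `<=` Y -> cone X `<=` cone Y.
Proof.
move=> XY; apply: cone_min; [exact: cone0|by move=> *; exact: coneD|].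
by move=> t x t0 /XY Yx; apply: coneZ => //; exact: cone_gen.
Qed.

Lemma cone_scalar_ge0 X l : (forall x, X x -> 0 <= l x) ->
  forall x, cone X x -> 0 <= l x.
Proof.
move=> lX; apply: cone_min => [|x y lx ly|t x t0 /lX lx] /=.
- by rewrite linear0.
- by rewrite linearD addr_ge0.
- by rewrite linearZ mulr_ge0.
Qed.

(** A sum of nonnegative terms vanishes only if every term does, so a face is generated by the
    generators that it contains. *)
Lemma cone_ker X l : (forall x, X x -> 0 <= l x) ->
  [set x | cone X x /\ l x = 0] = cone [set x | X x /\ l x = 0].
Proof.
move=> lX; apply/seteqP; split=> [x [Xx lx]|].
  suff : cone X `<=` [set x | 0 <= l x /\
      (l x = 0 -> cone [set x | X x /\ l x = 0] x)] by move=> /(_ x Xx)[_]; exact.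
  apply: cone_min => [|y z [ly hy] [lz hz]|t y t0 Xy] /=.
  - by rewrite linear0; split=> // _; exact: cone0.
  - rewrite linearD addr_ge0 //; split=> // /eqP; rewrite paddr_eq0 //.
    by move=> /andP[/eqP/hy ? /eqP/hz ?]; exact: coneD.
  - rewrite linearZ /= mulr_ge0 ?lX //; split=> // /eqP; rewrite mulf_eq0.
    move=> /orP[/eqP->|/eqP ly]; first by rewrite scale0r; exact: cone0.
    by apply: coneZ => //; apply: cone_gen.
apply: cone_min => [|y z [Xy ly] [Xz lz]|t y t0 [Xy ly]] /=.
- by rewrite linear0; split=> //; exact: cone0.
- by rewrite linearD ly lz addr0; split=> //; exact: coneD.
- by rewrite linearZ /= ly mulr0; split=> //; apply: coneZ => //; exact: cone_gen.
Qed.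

End Cone.

Lemma cone_image (R : realType) (V W : lmodType R) (f : {linear V -> W}) (X : set V) :
  f @` cone X = cone (f @` X).
Proof.
apply/seteqP; split=> [_ [x + <-]|].
  apply: (@cone_min R V X (fun x => cone (f @` X) (f x))) => [|y z|t y t0 Xy].
  - by rewrite linear0; exact: cone0.
  - by rewrite linearD; exact: coneD.
  - by rewrite linearZ; apply: coneZ => //; apply: cone_gen; exists y.
apply: cone_min => [|_ _ [y Xy <-] [z Xz <-]|t _ t0 [y Xy <-]].
- by exists 0; [exact: cone0|rewrite linear0].
- by exists (y + z); [exact: coneD|rewrite linearD].
- by exists (t *: y); [apply: coneZ => //; exact: cone_gen|rewrite linearZ].
Qed.

Lemma lspan_cone (R : realType) (V : vectType R) (X : set V) :
  lspan (cone X) = lspan X.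
Proof.
apply/eqP; rewrite eqEsubv; apply/andP; split; apply: lspan_subv.
  apply: (@cone_min R V X [set x | x \in lspan X]) => [|x y|t x t0 Xx] /=.
  - exact: mem0v.
  - by move=> *; rewrite memvD.
  - by rewrite memvZ // mem_lspan.
by move=> x Xx; apply: mem_lspan; exact: cone_gen.
Qed.

(** * Faces and facets of polyhedral cones, and the diamond property *)

Section Facets.
Variables (R : realType) (g : nat).
Notation V := 'M[R]_g.
Implicit Types (X : set V) (s f h : set V) (l m : {scalar V}).

Definition poly_cone s := exists2 X : set V, finite_set X & s = cone X.

Lemma face_sub f s : is_face f s -> f `<=` s.
Proof. by move=> [l [_ ->]] x []. Qed.

Lemma facet_sub f s : is_facet f s -> f `<=` s.
Proof. by case=> /face_sub. Qed.

Lemma poly_cone_face f s : poly_cone s -> is_face f s -> poly_cone f.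
Proof.
move=> [X finX ->] [l [l0 ->]].
have l0' x : X x -> 0 <= l x by move=> Xx; apply: l0; exact: cone_gen.
exists [set x | X x /\ l x = 0]; last exact: cone_ker.
by apply: sub_finite_set finX => x [].
Qed.

(** By [cone_ker] the subsets of a finite list of generators index all faces. *)
Lemma finite_faces s : poly_cone s -> finite_set [set f | is_face f s].
Proof.
move=> [X /finite_seqP[r XE] ->].
pose e (A : {set 'I_(size r)}) : set V := cone [set r`_i | i in [set` A]].
apply: (@sub_finite_set _ _ (range e)); last first.
  by apply: finite_image; exact: finite_finset.
move=> f [l [l0 ->]]; exists [set i : 'I_(size r) | l r`_i == 0]%SET => //.
have l0' x : X x -> 0 <= l x by move=> Xx; apply: l0; exact: cone_gen.
rewrite cone_ker // /e; congr cone; apply/seteqP; split=> [_ [i + <-]|x [+ lx]].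
  by rewrite /= inE => /eqP li; split=> //; rewrite XE /= mem_nth.
rewrite XE /= => xr; have ir : (index x r < size r)%N by rewrite index_mem.
by exists (Ordinal ir); rewrite /= ?inE /= nth_index ?lx.
Qed.

Lemma finite_facets s : poly_cone s -> finite_set [set f | is_facet f s].
Proof.
by move=> ps; apply: sub_finite_set (finite_faces ps) => f [].
Qed.

Lemma facet_neq f s : is_facet f s -> exists2 x, s x & ~ f x.
Proof.
move=> [fs df]; apply: contrapT => nx.
have sf : (lspan s <= lspan f)%VS.
  by apply: lspanS => x sx; apply: contrapT => nfx; apply: nx; exists x.
by move: df (dimvS sf); rewrite /cone_dim => <-; rewrite ltnn.
Qed.

Lemma facet_notin f s x : is_facet f s -> s x -> ~ f x -> x \notin lspan f.
Proof.
move=> [[l [l0 ->]] _] sx nfx; apply/negP => xf; apply: nfx; split=> //.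
by apply: (@lspan_eq0 _ _ _ _ _ _ xf) => y [].
Qed.

Lemma facet_lspan f s x : is_facet f s -> s x -> ~ f x ->
  (lspan f + <[x]>)%VS = lspan s.
Proof.
move=> fs sx nfx; apply/eqP; rewrite eqEdim.
rewrite dim_addv_line ?(facet_notin fs) //.
case: (fs) => _; rewrite /cone_dim => ->; rewrite leqnn andbT.
rewrite subv_add (lspanS (facet_sub fs)) /=.
by rewrite -memvE mem_lspan.
Qed.

Lemma facet_basis f s b x : is_facet f s -> s x -> ~ f x -> basis_of (lspan f) b ->
  basis_of (lspan s) (rcons b x).
Proof.
move=> fs sx nfx bf; rewrite -(facet_lspan fs sx nfx).
by apply: basis_rcons => //; exact: (facet_notin fs).
Qed.

(** Modulo the span of [f] the span of [s] is a line, and the functional exposing [f] is positive at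
    both [x] and [y]. *)
Lemma facet_ray f s x y : is_facet f s -> s x -> ~ f x -> s y -> ~ f y ->
  exists2 t : R, 0 < t & y - t *: x \in lspan f.
Proof.
move=> fs sx nfx sy nfy.
have := mem_lspan sy; rewrite -(facet_lspan fs sx nfx).
move=> /memv_addP[u uf [_ /vlineP[t ->] yE]]; exists t; last first.
  by rewrite yE addrK.
case: (fs) => -[l [l0 fE]] _.
have lu : l u = 0 by apply: (@lspan_eq0 _ _ _ _ _ _ uf) => z; rewrite fE => -[].
have pos z : s z -> ~ f z -> 0 < l z.
  move=> sz nfz; rewrite lt_neqAle l0 // andbT; apply/negP => /eqP lz.
  by apply: nfz; rewrite fE; split.
have ly : l y = t * l x by rewrite yE linearD lu add0r linearZ.
by have := pos y sy nfy; rewrite ly pmulr_lgt0 // pos.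
Qed.

Lemma is_facet_dim f s (l : {scalar V}) :
  (forall x, s x -> 0 <= l x) -> f = [set x | s x /\ l x = 0] ->
  forall x, s x -> l x != 0 -> ((\dim (lspan s)).-1 <= \dim (lspan f))%N ->
  is_facet f s.
Proof.
move=> l0 fE x sx lx df; split; first by exists l.
have fs : f `<=` s by rewrite fE => y [].
have xf : x \notin lspan f.
  apply: contra lx => xf; apply/eqP.
  by apply: (@lspan_eq0 _ _ _ _ _ _ xf) => y; rewrite fE => -[].
have : (lspan f + <[x]> <= lspan s)%VS.
  by rewrite subv_add (lspanS fs) -memvE mem_lspan.
move/dimvS; rewrite dim_addv_line // /cone_dim => dfs; apply/eqP.
rewrite eqn_leq dfs /=; move: df; case: (\dim (lspan s)) => // d.
Qed.

Lemma facet_inj f f' s : is_facet f s -> is_facet f' s -> f `<=` f' -> f = f'.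
Proof.
move=> fs f's ff'; apply/seteqP; split=> // x f'x; apply: contrapT => nfx.
have sx := facet_sub f's f'x.
have : (lspan s <= lspan f')%VS.
  by rewrite -(facet_lspan fs sx nfx) subv_add lspanS // -memvE mem_lspan.
by move/dimvS; case: f's => _; rewrite /cone_dim => <-; rewrite ltnn.
Qed.

(** Modulo the span of [h] the cone is planar, with [f] and [f'] as its two sides. The functional
    [m] that exposes [h] in [f] is rotated about [h], by subtracting a multiple of [l], until it
    touches a generator outside [f]. *)
Lemma diamond s f h : poly_cone s -> is_facet f s -> is_facet h f ->
  exists f' x y, [/\ is_facet f' s /\ is_facet h f',
    [/\ f x, ~ h x & ~ f' x], [/\ f' y, ~ h y & ~ f y] &
    forall e, is_facet e s -> is_facet h e -> e = f \/ e = f'].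
Proof.
move=> [X /finite_seqP[r XE] sE] fs hf.
have genX i : (i < size r)%N -> s r`_i.
  by move=> ir; rewrite sE; apply: cone_gen; rewrite XE /= mem_nth.
have [[[l [l0 fE]] _] [[m [m0 hE]] _]] := (fs, hf).
have [x fx nhx] := facet_neq hf.
have sx := facet_sub fs fx.
have mx : 0 < m x.
  rewrite lt_neqAle m0 // andbT; apply/negP => /eqP mx.
  by apply: nhx; rewrite hE.
have lx : l x = 0 by move: fx; rewrite fE => -[].
have [i0 li0] : exists i : 'I_(size r), 0 < l r`_i.
  apply: contrapT => nl; have [z sz nfz] := facet_neq fs.
  apply: nfz; rewrite fE; split=> //.
  suff : cone X `<=` [set z | l z = 0] by move/(_ z); rewrite -sE; apply.
  apply: cone_min => [|u v lu lv|t u t0] /=; first by rewrite linear0.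
    by rewrite linearD lu lv addr0.
  rewrite XE /= => ur; rewrite linearZ /= [l u](_ : _ = 0) ?mulr0 //.
  have ir : (index u r < size r)%N by rewrite index_mem.
  apply/eqP; rewrite eq_le l0 ?andbT; last first.
    by rewrite sE; apply: cone_gen; rewrite XE.
  rewrite leNgt; apply/negP => lu; apply: nl; exists (Ordinal ir).
  by rewrite /= nth_index.
(* [m] is known to be nonnegative only on [f], so the slope [t] may be negative. The least ratio
   makes [m - t * l] nonnegative on every generator and zero at [y]. *)
have [j lj jmin] : exists2 j : 'I_(size r), 0 < l r`_j &
    forall i : 'I_(size r), 0 < l r`_i -> m r`_j / l r`_j <= m r`_i / l r`_i.
  case: (@Order.TotalTheory.arg_minP _ _ _ i0 (fun i : 'I_(size r) => 0 < l r`_i)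
    (fun i => m r`_i / l r`_i) li0) => j lj jmin.
  by exists j.
pose y := r`_j; pose t := m y / l y.
have [n nE] : exists n : {scalar V}, forall z, n z = m z - t * l z.
  by apply: scalar_of_fun => a u v; rewrite !linearP /=; ring.
have sy : s y by exact: genX.
have n0 z : s z -> 0 <= n z.
  rewrite sE; apply: cone_scalar_ge0 => {}z Xz.
  have zr : z \in r by move: Xz; rewrite XE.
  have sz : s z by rewrite sE; exact: cone_gen.
  have ir : (index z r < size r)%N by rewrite index_mem.
  rewrite nE; have := l0 z sz; rewrite le_eqVlt => /orP[/eqP lz|lz].
    by rewrite -lz mulr0 subr0 m0 // fE.
  have := jmin (Ordinal ir); rewrite /= nth_index // => /(_ lz).
  by rewrite -/y -/t ler_pdivlMr // subr_ge0.
have lnh z : h z <-> [/\ s z, l z = 0 & n z = 0].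
  rewrite hE /= fE /= nE; split=> [[[sz lz] mz]|[sz lz]].
    by rewrite lz mz mulr0 subr0.
  by rewrite lz mulr0 subr0.
have nx : 0 < n x by rewrite nE lx mulr0 subr0.
have ny : n y = 0 by rewrite nE /t divfK ?subrr // gt_eqF.
have nhy : ~ h y by move=> /lnh[_ /eqP]; rewrite gt_eqF.
have nfy : ~ f y by rewrite fE => -[_ /eqP]; rewrite gt_eqF.
pose f' : set V := [set z | s z /\ n z = 0].
have f'y : f' y by [].
have nf'x : ~ f' x by case=> _ /eqP; rewrite gt_eqF.
have hs : h `<=` s by move=> z /lnh[].
have hf' : h `<=` f' by move=> z /lnh[].
have yh : y \notin lspan h.
  apply/negP => yh; move: lj; rewrite (@lspan_eq0 _ _ l h _ _ yh) ?ltxx //.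
  by move=> z /lnh[].
have ds : cone_dim s = (cone_dim h).+2 by case: fs => _ <-; case: hf => _ <-.
have dhf' : (cone_dim h < cone_dim f')%N.
  rewrite /cone_dim -(dim_addv_line yh); apply: dimvS.
  by rewrite subv_add lspanS // -memvE mem_lspan.
have f's : is_facet f' s.
  apply: (@is_facet_dim f' s n n0 erefl x sx); first by rewrite gt_eqF.
  by move: ds dhf'; rewrite /cone_dim => ->.
have hf'' : is_facet h f'.
  split; last by case: f's => _ df'; apply: succn_inj; rewrite df' ds.
  exists l; split=> [z [sz _]|]; first exact: l0.
  by apply/seteqP; split=> z; [move=> /lnh[]|move=> [[? ?] ?]; apply/lnh].
exists f', x, y; split=> // e es he.
have [[mu [mu0 eE]] _] := es.
have muh z : h z -> mu z = 0.
  by move=> /(facet_sub he); rewrite eE => -[].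
(* All of [l], [n], [mu] vanish on [h], and [l x = 0], [n y = 0]. So [l] and [n] are coordinates
   modulo the span of [h], and the coefficients of [mu] are read off at [x] and [y]. *)
have muE z : s z -> mu z * (n x * l y) = n z * l y * mu x + l z * n x * mu y.
  move=> sz.
  have [a aE] : exists a : {scalar V}, forall z, a z = mu z * (n x * l y).
    by apply: scalar_of_fun => k u v; rewrite linearP /=; ring.
  have [b bE] : exists b : {scalar V}, forall z,
      b z = n z * l y * mu x + l z * n x * mu y.
    by apply: scalar_of_fun => k u v; rewrite !linearP /=; ring.
  rewrite -aE -bE.
  have hz u : h u -> a u = b u.
    by move=> hu; have [_ lu nu] := (iffLR (lnh u)) hu; rewrite aE bE muh // lu nu; ring.
  have := mem_lspan sz.
  rewrite -(facet_lspan fs sy nfy) -(facet_lspan hf fx nhx).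
  move=> /memv_addP[_ /memv_addP[u uh [_ /vlineP[p ->] ->]] [_ /vlineP[q ->] ->]].
  rewrite !linearD !linearZ /= (lspan_eq hz uh).
  by rewrite !aE !bE lx ny; ring.
have [sx' sy'] := (mu0 x sx, mu0 y sy).
have nly : n x * l y != 0 by rewrite mulf_neq0 ?gt_eqF.
(* If [mu] vanishes at both points, then [e = s]; at [x] alone, [e = f]; at [y] alone, [e = f']; at
   neither, [e = h]. The first and the last contradict the dimensions. *)
have [mux|mux] := eqVneq (mu x) 0; have [muy|muy] := eqVneq (mu y) 0.
- have [z sz nez] := facet_neq es; exfalso; apply: nez; rewrite eE; split=> //.
  have /eqP := muE z sz; rewrite mux muy !mulr0 addr0 mulf_eq0 (negPf nly) orbF.
  by move/eqP.
- left; apply/esym; apply: (facet_inj fs es) => z fz.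
  have sz := facet_sub fs fz; move: fz; rewrite fE => -[_ lz].
  rewrite eE; split=> //; have /eqP := muE z sz.
  by rewrite mux lz !(mulr0, mul0r) addr0 mulf_eq0 (negPf nly) orbF => /eqP.
- right; apply/esym; apply: (facet_inj f's es) => z [sz nz].
  rewrite eE; split=> //; have /eqP := muE z sz.
  by rewrite muy nz !(mulr0, mul0r) addr0 mulf_eq0 (negPf nly) orbF => /eqP.
- suff eh : e = h.
    by case: he => _; rewrite eh => /eqP; rewrite eqn_leq ltnn.
  apply/seteqP; split; last exact: facet_sub.
  move=> z; rewrite eE => -[sz muz]; apply/lnh.
  have /esym/eqP := muE z sz; rewrite muz mul0r paddr_eq0; last 2 first.
  - by rewrite !mulr_ge0 // ?n0 // ltW.
  - by rewrite !mulr_ge0 // ?l0 // ltW.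
  rewrite !mulf_eq0 (negPf mux) (negPf muy) !(gt_eqF lj) !(gt_eqF nx) !orbF.
  by move=> /andP[/eqP ? /eqP ?]; split.
Qed.
End Facets.

(** * Cellular cochains *)

Section RelativeSign.
Variables (F : realFieldType) (V : vectType F).
Implicit Types (a b c : seq V) (U : {vspace V}).

Definition ors b c : rat := (-1) ^+ (~~ same_orientation b c).

Lemma ors_mul U a b c : basis_of U a -> basis_of U b -> basis_of U c ->
  ors a b * ors b c = ors a c.
Proof.
move=> aU bU cU; rewrite /ors (same_orientation_trans aU bU cU).
by do 2 case: same_orientation; rewrite /= ?mulr1 ?mul1r // mulrN1 opprK.
Qed.

Lemma ors_sym U a b : basis_of U a -> basis_of U b -> ors a b = ors b a.
Proof. by move=> aU bU; rewrite /ors (same_orientation_sym aU bU). Qed.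

Lemma ors_refl b : free b -> ors b b = 1.
Proof. by move=> fb; rewrite /ors same_orientation_refl. Qed.

Lemma ors_sqr a b : ors a b * ors a b = 1.
Proof. by rewrite /ors -expr2 sqrr_sign. Qed.

Lemma ors_rcons U b c x y t : free (rcons b x) -> basis_of U b -> basis_of U c ->
  y - t *: x \in U -> 0 < t -> ors (rcons b x) (rcons c y) = ors b c.
Proof. by move=> *; rewrite /ors (@same_orientation_rcons _ _ U _ _ _ _ t). Qed.

Lemma ors_swap b x y : free (rcons (rcons b x) y) ->
  ors (rcons (rcons b x) y) (rcons (rcons b y) x) = -1.
Proof. by move=> fb; rewrite /ors same_orientation_swap. Qed.
End RelativeSign.

Lemma eq_fsum (I : choiceType) (A : set I) (f h : I -> rat) :
  (forall i, A i -> f i = h i) -> \sum_(i \in A) f i = \sum_(i \in A) h i.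
Proof. by move=> fh; apply: eq_fsbigr => i /set_mem; exact: fh. Qed.

Lemma fsum_sub (I : choiceType) (A B : set I) (f : I -> rat) : A `<=` B ->
  \sum_(i \in A) f i = \sum_(i \in B) (if `[< A i >] then f i else 0).
Proof.
move=> AB; rewrite -(fsbig_widen A B) //.
  by apply: eq_fsum => i Ai; rewrite asboolT.
by move=> i [_ nA] /=; rewrite asboolF.
Qed.

Lemma fsum_only (I : choiceType) (A : set I) (i : I) (f : I -> rat) : A i ->
  (forall j, A j -> j != i -> f j = 0) -> \sum_(j \in A) f j = f i.
Proof.
move=> Ai f0; rewrite -(fsbig_widen [set i] A) ?fsbig_set1 //.
  by move=> _ ->.
by move=> j [Aj /eqP ji]; exact: f0.
Qed.

(** * The coboundary and its square *)

Section Coboundary.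
Variables (R : realType) (g : nat).
Notation V := 'M[R]_g.
Notation cochain := (set V -> seq V -> rat).
Implicit Types (s f h : set V) (b c : seq V) (F : cochain).

Definition lbasis s : seq V := vbasis (lspan s).

Lemma lbasisP s : basis_of (lspan s) (lbasis s).
Proof. exact: vbasisP. Qed.

(** The basis of [f] and the vector outside [f] are arbitrary choices; by [cobd_termE] any others
    give the same term when [F] alternates on [f]. *)
Definition cobd_term F s b f : rat :=
  ors b (rcons (lbasis f) (xget 0 (s `\` f))) * F f (lbasis f).

Definition cobd F : cochain := fun s b =>
  \sum_(f \in [set f | is_facet f s]) cobd_term F s b f.

Definition alternates F s : Prop := forall b c,
  basis_of (lspan s) b -> basis_of (lspan s) c -> F s c = ors b c * F s b.

Lemma ors_facet s f b c x y : is_facet f s ->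
  basis_of (lspan f) b -> basis_of (lspan f) c ->
  s x -> ~ f x -> s y -> ~ f y -> ors (rcons b x) (rcons c y) = ors b c.
Proof.
move=> fs bf cf sx nfx sy nfy.
have [t t0 yx] := facet_ray fs sx nfx sy nfy.
by apply: (ors_rcons _ bf cf yx t0); rewrite (basis_free (facet_basis fs sx nfx bf)).
Qed.

Lemma xget_facet s f : is_facet f s -> s (xget 0 (s `\` f)) /\ ~ f (xget 0 (s `\` f)).
Proof.
by move=> fs; have [x sx nfx] := facet_neq fs; apply: (@xgetPex _ 0 (s `\` f)); exists x.
Qed.

Lemma cobd_termE F s f b c x : is_facet f s -> alternates F f ->
  basis_of (lspan s) b -> basis_of (lspan f) c -> s x -> ~ f x ->
  cobd_term F s b f = ors b (rcons c x) * F f c.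
Proof.
move=> fs aF bs cf sx nfx; have [sy nfy] := xget_facet fs; rewrite /cobd_term.
rewrite (aF _ _ cf (lbasisP f)) mulrA; congr (_ * _).
rewrite -(ors_facet fs cf (lbasisP f) sx nfx sy nfy).
rewrite (ors_sym (facet_basis fs sx nfx cf) (facet_basis fs sy nfy (lbasisP f))).
by rewrite (ors_mul bs (facet_basis fs sy nfy (lbasisP f)) (facet_basis fs sx nfx cf)).
Qed.

Lemma cobd_alternates F s : alternates (cobd F) s.
Proof.
move=> b c bs cs; rewrite /cobd mulr_fsumr; apply: eq_fsum => f fs.
have [sy nfy] := xget_facet fs.
have bfy := facet_basis fs sy nfy (lbasisP f).
rewrite /cobd_term mulrA; congr (_ * _).
by rewrite (ors_sym bs cs) (ors_mul cs bs bfy).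
Qed.

(** After exchanging the sums, the diamond leaves for each [h] exactly two facets between [h] and
    [s], and their contributions differ by the order of the last two basis vectors. *)
Lemma cobd_cobd F s b : poly_cone s -> basis_of (lspan s) b ->
  (forall f h, is_facet f s -> is_facet h f -> alternates F h) ->
  cobd (cobd F) s b = 0.
Proof.
move=> ps bs aF; pose A := [set f | is_facet f s].
have finA : finite_set A by exact: finite_facets.
pose H := \bigcup_(f in A) [set h | is_facet h f].
have finH : finite_set H.
  apply: bigcup_finite => // f [fs _]; apply: finite_facets.
  exact: poly_cone_face ps fs.
pose x f := xget 0 (s `\` f).
transitivity (\sum_(f \in A) \sum_(h \in H) (if `[< is_facet h f >] then
    ors b (rcons (lbasis f) (x f)) * cobd_term F f (lbasis f) h else 0)).
  apply: eq_fsum => f fs; rewrite /cobd_term mulr_fsumr.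
  rewrite (@fsum_sub _ [set h | is_facet h f] H) //.
  by move=> h hf; exists f.
rewrite exchange_fsbig //; apply: fsbig1 => h [f fs hf].
have [f' [u [v [[f's hf'] [fu nhu nf'u] [f'v nhv nfv] ff']]]] := diamond ps fs hf.
have su := facet_sub fs fu; have sv := facet_sub f's f'v.
have bh := lbasisP h; have ah := aF _ _ fs hf.
(* The contribution of a facet [e] through [h], written with any admissible [p] and [q]: the pair is
   [u, v] for [f] and [v, u] for [f']. *)
have E e p q : is_facet e s -> is_facet h e -> e p -> ~ h p -> s q -> ~ e q ->
  ors b (rcons (lbasis e) (x e)) * cobd_term F e (lbasis e) h =
  ors b (rcons (rcons (lbasis h) p) q) * F h (lbasis h).
  move=> es he ep nhp sq neq.
  rewrite (cobd_termE he ah (lbasisP e) bh ep nhp) mulrA; congr (_ * _).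
  have [sx nex] := xget_facet es; have hp := facet_basis he ep nhp bh.
  rewrite -(ors_facet es (lbasisP e) hp sx nex sq neq).
  apply: (ors_mul bs); first exact: (facet_basis es sx nex (lbasisP e)).
  exact: (facet_basis es sq neq hp).
have f'f : f' <> f by move=> ff; apply: nfv; rewrite -ff.
rewrite (fsbigD1 f) // asboolT // (fsbigD1 f'); last 2 first.
- exact: finite_setD.
- by split.
rewrite asboolT // fsbig1; last first.
  move=> e [[es nef] nef']; case: asboolP => // he.
  by case: (ff' e es he).
rewrite /= addr0 (E f u v) // (E f' v u) //.
have hu := facet_basis hf fu nhu bh; have hv := facet_basis hf' f'v nhv bh.
have huv := facet_basis fs sv nfv hu; have hvu := facet_basis f's su nf'u hv.
rewrite -(ors_mul bs huv hvu) ors_swap ?(basis_free huv) //.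
by rewrite mulrN1 mulNr subrr.
Qed.
End Coboundary.

(** * Positive definite forms *)

Section QuadraticForms.
Variables (R : realType) (g : nat).
Notation V := 'M[R]_g.
Implicit Types (Q L : V) (x y : 'cV[R]_g) (v w : 'cV[int]_g) (l : {scalar V}).

Lemma qval_comb Q x y (a b : R) : Q^T = Q ->
  qval Q (a *: x + b *: y) =
  a ^+ 2 * qval Q x + (a * b) *+ 2 * (x^T *m Q *m y) 0 0 + b ^+ 2 * qval Q y.
Proof.
move=> Qs; have yx : (y^T *m Q *m x) 0 0 = (x^T *m Q *m y) 0 0.
  rewrite -[RHS](mxE (trmx_key) (fun i j => (x^T *m Q *m y) j i) 0 0).
  by rewrite -/(trmx _) !trmx_mul trmxK Qs mulmxA.
have -> : qval Q (a *: x + b *: y) = ((a *: x^T + b *: y^T) *m Q *m (a *: x + b *: y)) 0 0.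
  by rewrite /qval; congr ((_ *m _ *m _) 0 0); apply/matrixP => i j; rewrite !mxE.
rewrite !(mulmxDl, mulmxDr, =^~ scalemxAl, =^~ scalemxAr).
move: yx; rewrite /qval; set A := x^T *m Q *m x; set B := y^T *m Q *m y.
set C := x^T *m Q *m y; set D := y^T *m Q *m x => yx.
by clearbody A B C D; rewrite !mxE yx; ring.
Qed.

Lemma posdef_ge0 Q x : posdef Q -> 0 <= qval Q x.
Proof.
move=> [_ Q0]; have [->|/Q0/ltW//] := eqVneq x 0.
by rewrite /qval mulmx0 mxE.
Qed.

Lemma posdef_CauchySchwarz Q x y : posdef Q ->
  ((x^T *m Q *m y) 0 0) ^+ 2 <= qval Q x * qval Q y.
Proof.
move=> pQ; have [Qs Q0] := pQ; have [->|y0] := eqVneq y 0.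
  by rewrite /qval !mulmx0 !mxE expr0n mulr0.
have qy := Q0 y y0.
set B := (x^T *m Q *m y) 0 0.
have := posdef_ge0 (qval Q y *: x + (- B) *: y) pQ.
rewrite qval_comb // -/B.
set p := qval Q x; set q := qval Q y.
have -> : q ^+ 2 * p + (q * - B) *+ 2 * B + (- B) ^+ 2 * q = q * (p * q - B ^+ 2) by ring.
by rewrite pmulr_rge0 // subr_ge0.
Qed.

Lemma posdef_unit Q : posdef Q -> Q \in unitmx.
Proof.
move=> [_ Q0]; rewrite -row_free_unit -kermx_eq0; apply/negPn/negP => /rowV0Pn[u].
move=> /sub_kermxP uQ u0; have := Q0 u^T.
by rewrite /qval trmxK uQ mul0mx mxE ltxx trmx_eq0 => /(_ u0).
Qed.

(** The [i]-th coordinate of [x] is its scalar product under [Q] with [Q^-1 e_i], so Cauchy-Schwarz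
    bounds it. The summand 1 keeps the constant positive. *)
Lemma posdef_coord_bound Q : posdef Q ->
  exists2 K : R, 0 < K & forall x i, (x i 0) ^+ 2 <= K * qval Q x.
Proof.
move=> pQ; pose y i : 'cV[R]_g := invmx Q *m delta_mx i 0.
exists (1 + \sum_i qval Q (y i)) => [|x i].
  by rewrite ltr_wpDr // sumr_ge0 // => i _; exact: posdef_ge0.
have -> : x i 0 = (x^T *m Q *m y i) 0 0.
  rewrite /y -mulmxA mulKVmx ?posdef_unit //.
  by rewrite -colE !mxE.
apply: le_trans (posdef_CauchySchwarz _ _ pQ) _; rewrite mulrC.
apply: ler_wpM2r; first exact: posdef_ge0.
rewrite (bigD1 i) //= addrCA lerDl addr_ge0 // sumr_ge0 // => j _.
exact: posdef_ge0.
Qed.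

Lemma scalar_sqr_sum l x :
  l (x *m x^T) = \sum_i \sum_j x i 0 * x j 0 * l (delta_mx i j).
Proof.
rewrite [x *m x^T]matrix_sum_delta linear_sum; apply: eq_bigr => i _.
rewrite linear_sum; apply: eq_bigr => j _.
by rewrite linearZ /= !mxE big_ord1 mxE.
Qed.

(** On [x x^T] a functional is a combination of products of two coordinates, each bounded by a
    multiple of [Q(x)]. Hence a small perturbation of [Q] by [l] remains positive definite. *)
Lemma posdef_scalar_bound Q l : posdef Q ->
  exists2 K : R, 0 < K & forall x, `|l (x *m x^T)| <= K * qval Q x.
Proof.
move=> pQ; have [K K0 KQ] := posdef_coord_bound pQ.
exists (1 + K * \sum_i \sum_j `|l (delta_mx i j)|) => [|x].
  rewrite ltr_wpDr // mulr_ge0 ?(ltW K0) // sumr_ge0 // => i _.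
  by rewrite sumr_ge0.
rewrite scalar_sqr_sum mulrDl mul1r ler_wpDl ?posdef_ge0 //.
apply: le_trans (ler_norm_sum _ _ _) _.
rewrite mulrAC mulr_sumr; apply: ler_sum => i _.
apply: le_trans (ler_norm_sum _ _ _) _.
rewrite mulr_sumr; apply: ler_sum => j _.
rewrite normrM; apply: ler_wpM2r => //.
have := KQ x i; have := KQ x j; set a := x i 0; set b := x j 0.
move: (K * qval Q x) => q bq aq.
rewrite ler_norml; have := sqr_ge0 (a - b); have := sqr_ge0 (a + b).
by move=> h1 h2; apply/andP; split; nra.
Qed.

(** The coefficients are symmetrized because [l] lives on all matrices, while [posdef] asks for a
    symmetric one. *)
Lemma scalar_matrix l : exists2 L : V, L^T = L & forall x, qval L x = l (x *m x^T).
Proof.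
exists (\matrix_(i, j) ((l (delta_mx i j) + l (delta_mx j i)) / 2)).
  by apply/matrixP => i j; rewrite !mxE addrC.
move=> x; rewrite scalar_sqr_sum.
transitivity (\sum_i \sum_j x i 0 * x j 0 * ((l (delta_mx i j) + l (delta_mx j i)) / 2)).
  rewrite /qval mxE exchange_big /=; apply: eq_bigr => j _.
  rewrite mxE mulr_suml; apply: eq_bigr => i _; rewrite !mxE; ring.
have -> : \sum_i \sum_j x i 0 * x j 0 * ((l (delta_mx i j) + l (delta_mx j i)) / 2) =
  (\sum_i \sum_j x i 0 * x j 0 * l (delta_mx i j)) / 2 +
  (\sum_i \sum_j x i 0 * x j 0 * l (delta_mx j i)) / 2.
  rewrite !mulr_suml -big_split; apply: eq_bigr => i _.
  rewrite !mulr_suml -big_split; apply: eq_bigr => j _ /=; ring.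
rewrite [X in _ + X / 2]exchange_big /=.
have -> : \sum_i \sum_j x j 0 * x i 0 * l (delta_mx i j) =
  \sum_i \sum_j x i 0 * x j 0 * l (delta_mx i j).
  by apply: eq_bigr => i _; apply: eq_bigr => j _; rewrite [x j 0 * _]mulrC.
by rewrite -splitr.
Qed.

Definition zq Q v : R := qval Q (intvec R v).

Lemma finite_bounded_intvec (N : nat) :
  finite_set [set v : 'cV[int]_g | forall i, `|v i 0| <= N%:Z].
Proof.
pose f (e : {ffun 'I_g -> 'I_(N + N).+1}) : 'cV[int]_g := \col_i ((e i)%:Z - N%:Z).
apply: (@sub_finite_set _ _ (range f)); last first.
  by apply: finite_image; exact: finite_finset.
move=> v vN; exists [ffun i => inord (absz (v i 0 + N%:Z))] => //.
apply/colP => i; rewrite mxE ffunE inordK; have := vN i; last first.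
  by rewrite ltnS; lia.
by lia.
Qed.

Lemma finite_zq_le Q (C : R) : posdef Q -> finite_set [set v | zq Q v <= C].
Proof.
move=> pQ; have [K K0 KQ] := posdef_coord_bound pQ.
have [N NE] : exists N : nat, K * C <= N%:R.
  exists (Num.bound `|K * C|).
  exact: le_trans (ler_norm _) (ltW (archi_boundP (normr_ge0 _))).
apply: sub_finite_set (finite_bounded_intvec N) => v /= vC i.
have : ((v i 0) ^+ 2)%:~R <= (N%:Z)%:~R :> R.
  rewrite rmorphXn /=; have := KQ (intvec R v) i; rewrite mxE => /le_trans; apply.
  by apply: le_trans NE; rewrite ler_pM2l.
rewrite ler_int; nia.
Qed.

Lemma pos_lower_bound (r : seq R) :
  exists2 d : R, 0 < d & forall a, a \in r -> 0 < a -> d <= a.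
Proof.
elim: r => [|b r [d d0 dr]]; first by exists 1.
have [b0|b0] := ltP 0 b; last first.
  exists d => // a; rewrite inE => /orP[/eqP->|/dr//]; by rewrite ltNge b0.
exists (Num.min d b) => [|a]; first by rewrite lt_min d0.
by rewrite inE ge_min => /orP[/eqP->|/dr da /da ->//]; rewrite lexx orbT.
Qed.

(** Only finitely many lattice vectors have value at most [m + 1], so the values above [m] stay away
    from [m]. The vectors beyond [m + 1] account for the minimum with 1. *)
Lemma zq_gap Q (m : R) : posdef Q ->
  exists2 d : R, 0 < d & forall v, m < zq Q v -> m + d <= zq Q v.
Proof.
move=> pQ; have /finite_seqP[r rE] := finite_zq_le (m + 1) pQ.
have [d d0 dr] := pos_lower_bound [seq zq Q v - m | v <- r].
exists (Num.min d 1) => [|v mv]; first by rewrite lt_min d0 ltr01.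
have [v1|v1] := leP (zq Q v) (m + 1); last first.
  by apply: le_trans (ltW v1); rewrite lerD2l ge_min lexx orbT.
have vr : v \in r by move/seteqP: rE => [+ _]; apply.
rewrite -lerBrDl ge_min dr // ?subr_gt0 //.
by apply: map_f.
Qed.

End QuadraticForms.

(** * Perfect cones *)

Section Presentations.
Variables (R : realType) (g : nat).
Notation V := 'M[R]_g.
Implicit Types (Q L : V) (x y : 'cV[R]_g) (v w : 'cV[int]_g) (l : {scalar V}).
Implicit Types (s f : set V) (M : set 'cV[int]_g) (h : 'M[int]_g).

Lemma intvec0 : intvec R (0 : 'cV[int]_g) = 0.
Proof. exact: map_mx0. Qed.

Lemma intvecN v : intvec R (- v) = - intvec R v.
Proof. exact: map_mxN. Qed.

Lemma intvec_inj : injective (@intvec R g).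
Proof.
move=> v w /colP vw; apply/colP => i; have := vw i; rewrite !mxE.
exact: intr_inj.
Qed.

Lemma intvec_eq0 v : (intvec R v == 0) = (v == 0).
Proof. by rewrite -intvec0 (inj_eq intvec_inj). Qed.

Lemma trmxN m n (A : 'M[R]_(m, n)) : (- A)^T = - A^T.
Proof. by apply/matrixP => i j; rewrite !mxE. Qed.

Lemma sqformN v : sqform R (- v) = sqform R v.
Proof. by rewrite /sqform intvecN trmxN mulmxN mulNmx opprK. Qed.

Lemma zqN Q v : zq Q (- v) = zq Q v.
Proof. by rewrite /zq intvecN /qval trmxN mulmxN !mulNmx opprK. Qed.

Definition zcone M : set V := cone [set sqform R v | v in M].

Lemma sigma_coneE Q : sigma_cone Q = zcone (minvec Q).
Proof.
apply/seteqP; split=> X [k [a]].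
  move=> [v [av ->]]; exists k, a, (fun i => sqform R (v i)); split=> // i.
  by have [? ?] := av i; split=> //; exists (v i).
move=> [y [ay ->]].
have /choice[v vy] : forall i, exists v, minvec Q v /\ sqform R v = y i.
  by move=> i; have [_ [v ? ?]] := ay i; exists v.
exists k, a, v; split=> [i|].
  by have [? _] := ay i; have [? _] := vy i.
by apply: eq_bigr => i _; have [_ ->] := vy i.
Qed.

(** [m] is a lower bound that need not be attained. An empty [M] gives the zero cone, so both cases
    of [perfect_cone] are treated alike; [m] is also the coefficient of phi^2 in the inflated
    form. *)
Definition pres s M : Prop := exists (Q : V) (m : R),
  [/\ posdef Q, 0 < m, forall v, v != 0 -> m <= zq Q v,
      M = [set v | v != 0 /\ zq Q v = m] & s = zcone M].

Lemma posdef1 : posdef (1%:M : V).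
Proof.
split=> [|x x0]; first exact: trmx1.
rewrite /qval mulmx1 mxE; have [i xi] : exists i, x i 0 != 0.
  apply: contrapT => nx; move/negP: x0; apply; apply/eqP/colP => i.
  by rewrite mxE; apply: contrapT => /eqP xi; apply: nx; exists i.
rewrite (bigD1 i) //= ltr_pwDl //; last first.
  by rewrite sumr_ge0 // => j _; rewrite mxE -expr2 sqr_ge0.
by rewrite mxE -expr2 exprn_even_gt0.
Qed.

Lemma zcone_set0 : zcone set0 = [set 0].
Proof.
rewrite /zcone image_set0; apply/seteqP; split=> [|_ ->]; last exact: cone0.
apply: cone_min => //= x y -> ->; exact: addr0.
Qed.

Lemma pres_sigma Q v : posdef Q -> minvec Q v -> pres (sigma_cone Q) (minvec Q).
Proof.
move=> pQ [v0 vmin]; exists Q, (zq Q v); split=> //.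
- by case: pQ => _; apply; rewrite intvec_eq0.
- apply/seteqP; split=> w [w0 wE]; split=> //.
    by apply/eqP; rewrite eq_le wE // vmin.
  by move=> u u0; rewrite -/(zq Q w) wE vmin.
- exact: sigma_coneE.
Qed.

Lemma perfect_pres s : perfect_cone s -> exists M, pres s M.
Proof.
case=> [->|[Q pQ ->]].
  (* For the zero cone: the identity form, with a bound strictly below all its values at nonzero
     lattice vectors. *)
  have [K K0 KQ] := posdef_coord_bound posdef1; exists set0.
  have Kz v : v != 0 -> K^-1 <= zq (1%:M : V) v.
    move=> v0; have [i vi] : exists i, v i 0 != 0.
      apply: contrapT => nx; move/negP: v0; apply; apply/eqP/colP => i.
      by rewrite mxE; apply: contrapT => /eqP xi; apply: nx; exists i.
    rewrite -[K^-1]mul1r ler_pdivrMr // mulrC; apply: le_trans (KQ _ i).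
    by rewrite mxE -rmorphXn /= -[1]/(1%:~R) ler_int; nia.
  exists 1%:M, (K^-1 / 2); split=> //.
  - exact: posdef1.
  - by rewrite divr_gt0 // invr_gt0.
  - by move=> v /Kz; move: K0; rewrite -invr_gt0; lra.
  - by apply/seteqP; split=> // v [/Kz + vE]; move: K0; rewrite vE -invr_gt0; lra.
  - by rewrite zcone_set0.
exists (minvec Q); have [[v vmin]|nv] := pselect (exists v, minvec Q v).
  exact: pres_sigma vmin.
(* Without minimal vectors the cone is again zero, and half of the gap above 0 is a bound that is
   not attained. *)
have [d d0 dr] := zq_gap 0 pQ.
have Q0 w : w != 0 -> d <= zq Q w.
  move=> w0; rewrite -[d]add0r; apply: dr.
  by case: pQ => _; apply; rewrite intvec_eq0.
have me : minvec Q = set0 by apply/seteqP; split=> // w mw; apply: nv; exists w.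
exists Q, (d / 2); split=> //.
- by rewrite divr_gt0.
- by move=> w /Q0; lra.
- by rewrite me; apply/seteqP; split=> // w [/Q0 + wE]; rewrite wE; lra.
- exact: sigma_coneE.
Qed.

Lemma pres_perfect s M : pres s M -> perfect_cone s.
Proof.
move=> [Q [m [pQ m0 Qm ME ->]]].
have [[v Mv]|nv] := pselect (exists v, M v); last first.
  left; rewrite (_ : M = set0) ?zcone_set0 //.
  by apply/seteqP; split=> // v Mv; apply: nv; exists v.
right; exists Q => //; rewrite sigma_coneE; congr zcone; rewrite ME.
move: Mv; rewrite ME => -[v0 vm].
apply/seteqP; split=> w [w0 wE]; split=> //.
  by move=> u u0; rewrite -/(zq Q w) wE; exact: Qm.
by apply/eqP; rewrite eq_le Qm // -vm wE.
Qed.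

Lemma pres_minvec s M : pres s M -> M !=set0 ->
  exists Q, [/\ posdef Q, s = sigma_cone Q & minvec Q = M].
Proof.
move=> [Q [m [pQ m0 Qm ME sE]]] [v Mv]; exists Q.
suff mM : minvec Q = M by split=> //; rewrite sigma_coneE mM.
rewrite ME; move: Mv; rewrite ME => -[v0 vm].
apply/seteqP; split=> w [w0 wE]; split=> //.
  by apply/eqP; rewrite eq_le Qm // -vm wE.
by move=> u u0; rewrite -/(zq Q w) wE; exact: Qm.
Qed.

Lemma presN s M v : pres s M -> M v -> M (- v).
Proof.
by move=> [Q [m [_ _ _ -> _]]] [v0 vm]; split; rewrite ?oppr_eq0 ?zqN.
Qed.

Lemma pres_finite s M : pres s M -> finite_set M.
Proof.
move=> [Q [m [pQ _ _ -> _]]]; apply: sub_finite_set (finite_zq_le m pQ).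
by move=> v [_ vm]; rewrite /= vm.
Qed.

Lemma pres_poly s M : pres s M -> poly_cone s.
Proof.
move=> ps; exists [set sqform R v | v in M].
  by apply: finite_image; exact: pres_finite ps.
by case: ps => ? [? []].
Qed.

Lemma pres_neq0 s M v : pres s M -> M v -> v != 0.
Proof. by move=> [Q [m [_ _ _ -> _]]] []. Qed.

Lemma zq_scale Q v w (c : R) : intvec R v = c *: intvec R w ->
  zq Q v = c ^+ 2 * zq Q w.
Proof.
move=> vw; rewrite /zq vw /qval; have -> : (c *: intvec R w)^T = c *: (intvec R w)^T.
  by apply/matrixP => i j; rewrite !mxE.
by rewrite -!(scalemxAl, scalemxAr) scalerA mxE.
Qed.

(* The functional X |-> |w|^2 tr X - w^T X w sends x x^T to
   |w|^2 |x|^2 - (w.x)^2, which vanishes only on multiples of w. *)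
Lemma line_functional w : w != 0 -> exists l : {scalar V},
  [/\ forall v, 0 <= l (sqform R v), l (sqform R w) = 0 &
  forall v, l (sqform R v) = 0 -> exists c : R, intvec R v = c *: intvec R w].
Proof.
move=> w0; set y := intvec R w; have y0 : y != 0 by rewrite intvec_eq0.
pose q (x : 'cV[R]_g) := qval (1%:M : V) x.
have qy : 0 < q y by case: posdef1 => _; apply.
have [l lE] : exists l : {scalar V}, forall X,
    l X = q y * \tr X - (y^T *m X *m y) 0 0.
  apply: scalar_of_fun => a X Y.
  rewrite !(linearD, linearZ) /= !(mulmxDl, mulmxDr, =^~ scalemxAl, =^~ scalemxAr).
  by rewrite !mxE; ring.
have lx v : l (sqform R v) = q y * q (intvec R v) - ((intvec R v)^T *m y) 0 0 ^+ 2.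
  rewrite lE /sqform mxtrace_mulC /mxtrace big_ord1.
  set x := intvec R v.
  have -> : (x^T *m x) 0 0 = q x by rewrite /q /qval mulmx1.
  congr (_ - _); rewrite mulmxA -mulmxA mxE big_ord1 expr2; congr (_ * _).
  by rewrite !mxE; apply: eq_bigr => i _; rewrite !mxE mulrC.
have yy : (y^T *m y) 0 0 = q y by rewrite /q /qval mulmx1.
exists l; split=> [v||v]; rewrite lx; last set x := intvec R v; last set B := (x^T *m y) 0 0.
- set x := intvec R v; set B := (x^T *m y) 0 0.
  rewrite subr_ge0 mulrC; have := posdef_CauchySchwarz x y posdef1.
  by rewrite mulmx1.
- by rewrite yy; ring.
move=> lv; exists (B / q y); apply/eqP; rewrite -subr_eq0; apply/negPn/negP => xy.
have := (posdef1).2 _ xy.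
have := qval_comb x y (q y) (- B) (trmx1 R g); rewrite mulmx1 -/B -/(q x) -/(q y).
have -> : q y ^+ 2 * q x + (q y * - B) *+ 2 * B + (- B) ^+ 2 * q y =
   q y * (q y * q x - B ^+ 2) by ring.
rewrite lv mulr0 => q0 qp.
have := (posdef1).2 (q y *: x + - B *: y); rewrite q0 ltxx.
suff -> : q y *: x + - B *: y = q y *: (x - (B / q y) *: y).
  by rewrite scaler_eq0 (gt_eqF qy) (negPf xy) => /(_ isT).
by rewrite scalerBr scalerA mulrCA divff ?gt_eqF // mulr1 scaleNr.
Qed.

End Presentations.

(** * Inflation *)

Section Inflation.
Variables (R : realType) (g : nat).
Notation V := 'M[R]_g.
Implicit Types (s f e : set V) (x : V) (l : {scalar V}).

Definition infl s x : set V :=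
  [set Y | exists (X : V) (t : R), [/\ s X, 0 <= t & Y = X + t *: x]].

Lemma infl_sub s x : s `<=` infl s x.
Proof. by move=> X sX; exists X, 0; rewrite scale0r addr0. Qed.

Lemma infl_apex s x : s 0 -> infl s x x.
Proof. by move=> s0; exists 0, 1; rewrite scale1r add0r ler01. Qed.

Lemma lspan_infl s x : s 0 -> lspan (infl s x) = (lspan s + <[x]>)%VS.
Proof.
move=> s0; apply/eqP; rewrite eqEsubv; apply/andP; split.
  apply: lspan_subv => _ [X [t [sX _ ->]]].
  by rewrite memv_add ?mem_lspan // memvZ // memv_line.
rewrite subv_add (lspanS (@infl_sub s x)) -memvE mem_lspan //; exact: infl_apex.
Qed.

Variables (s : set V) (x : V) (l0 : {scalar V}).
Hypotheses (s0 : s 0) (l0s : forall X, s X -> l0 X = 0) (l0x : l0 x = 1).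

Lemma infl_apex_notin : x \notin lspan s.
Proof.
apply/negP => /(lspan_eq0 l0s); rewrite l0x => /eqP.
by rewrite oner_eq0.
Qed.

Lemma infl_basis b : basis_of (lspan s) b -> basis_of (lspan (infl s x)) (rcons b x).
Proof. by move=> bs; rewrite lspan_infl //; apply: basis_rcons => //; exact: infl_apex_notin. Qed.

Lemma infl_dim : cone_dim (infl s x) = (cone_dim s).+1.
Proof. by rewrite /cone_dim lspan_infl // dim_addv_line // infl_apex_notin. Qed.

(** The functional [l0] measures the coefficient of the apex, so its zero slice undoes the
    inflation. *)
Lemma infl_inter f : f `<=` s -> f = [set X | infl f x X /\ l0 X = 0].
Proof.
move=> fs; apply/seteqP; split=> [X fX|_ [[X [t [fX t0 ->]]]]].
  by split; [exact: infl_sub|exact/l0s/fs].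
rewrite linearD linearZ /= (l0s (fs _ fX)) l0x mulr1 add0r => ->.
by rewrite scale0r addr0.
Qed.

Lemma infl_facet_base : is_facet s (infl s x).
Proof.
split; last by rewrite infl_dim.
exists l0; split; last exact: infl_inter.
by move=> _ [X [t [sX t0 ->]]]; rewrite linearD linearZ /= l0s // l0x add0r mulr1.
Qed.

Lemma infl_notin f : f `<=` s -> ~ f x.
Proof. by move=> fs /fs/mem_lspan; apply/negP; exact: infl_apex_notin. Qed.

Lemma face0 f e : is_face f e -> e 0 -> f 0.
Proof. by move=> [l [_ ->]] e0; split=> //; exact: linear0. Qed.

End Inflation.

(** * The facets of an inflated cone *)

Section InflationFacets.
Variables (R : realType) (g : nat).
Notation V := 'M[R]_g.
Implicit Types (f e : set V) (l : {scalar V}).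
Variables (s : set V) (x : V) (l0 : {scalar V}).
Hypotheses (s0 : s 0) (l0s : forall X, s X -> l0 X = 0) (l0x : l0 x = 1).

Lemma infl_facet f : is_facet f s -> is_facet (infl f x) (infl s x).
Proof.
move=> fs; have f0 : f 0 by case: fs => /face0 + _; exact.
have l0f X : f X -> l0 X = 0 by move/(facet_sub fs); exact: l0s.
have [[l [lge fE]] df] := fs; split; last first.
  by rewrite (infl_dim f0 l0f l0x) (infl_dim s0 l0s l0x) df.
(* The corrected functional vanishes at the apex and agrees with [l] on [s]. *)
have [m mE] : exists m : {scalar V}, forall X, m X = l X - l x * l0 X.
  by apply: scalar_of_fun => a u v; rewrite !linearP /=; ring.
have ms X t : s X -> m (X + t *: x) = l X.
  by move=> sX; rewrite mE !linearD !linearZ /= l0s // l0x; ring.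
exists m; split=> [_ [X [t [sX t0 ->]]]|]; first by rewrite ms // lge.
apply/seteqP; split=> [Y|_ [[X [t [sX t0 ->]]]]].
  move=> [X [t [fX t0 ->]]]; move: (fX); rewrite fE => -[sX lX].
  by split; [exists X, t|rewrite ms].
by rewrite ms // => lX; exists X, t; split=> //; rewrite fE.
Qed.

(** An exposing functional that is positive at the apex can vanish only on elements of [s]; one that
    is zero there cuts out the inflation of a face of [s]. *)
Lemma infl_facetP e : is_facet e (infl s x) ->
  e = s \/ exists2 f, is_facet f s & e = infl f x.
Proof.
move=> es; have [[l [lge eE]] de] := es.
have lx : 0 <= l x by apply: lge; exact: infl_apex.
have ls X : s X -> 0 <= l X by move=> sX; apply: lge; exact: infl_sub.
pose f := [set X | s X /\ l X = 0].
have [lx0|lxn] := eqVneq (l x) 0; last first.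
  left; apply: (facet_inj es (infl_facet_base s0 l0s l0x)) => Y.
  rewrite eE => -[[X [t [sX t0 ->]]]]; rewrite linearD linearZ /= => /eqP.
  rewrite paddr_eq0 ?(mulr_ge0 t0 lx) ?(ls _ sX) //. rewrite mulf_eq0 (negPf lxn) orbF.
  by move=> /andP[_ /eqP->]; rewrite scale0r addr0.
right; exists f; last first.
  rewrite eE; apply/seteqP; split=> [Y [[X [t [sX t0 ->]]]]|_ [X [t [[sX lX] t0 ->]]]].
    by rewrite linearD linearZ /= lx0 mulr0 addr0 => lX; exists X, t.
  by split; [exists X, t|rewrite linearD linearZ /= lx0 lX mulr0 addr0].
have eif : e = infl f x.
  rewrite eE; apply/seteqP; split=> [Y [[X [t [sX t0 ->]]]]|_ [X [t [[sX lX] t0 ->]]]].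
    by rewrite linearD linearZ /= lx0 mulr0 addr0 => lX; exists X, t.
  by split; [exists X, t|rewrite linearD linearZ /= lx0 lX mulr0 addr0].
split; first by exists l.
have f0 : f 0 by split=> //; exact: linear0.
have l0f X : f X -> l0 X = 0 by move=> [sX _]; exact: l0s.
by move: de; rewrite eif (infl_dim f0 l0f l0x) (infl_dim s0 l0s l0x) => -[].
Qed.

Lemma infl_inj f e : f `<=` s -> e `<=` s -> infl f x = infl e x -> f = e.
Proof.
by move=> fs es fe; rewrite (infl_inter l0s l0x fs) fe -(infl_inter l0s l0x es).
Qed.

End InflationFacets.

(** * Uniqueness of the minimal vectors; faces of perfect cones *)

Section Presentations.
Variables (R : realType) (g : nat).
Notation V := 'M[R]_g.
Implicit Types (Q L : V) (x y : 'cV[R]_g) (v w : 'cV[int]_g) (l : {scalar V}).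
Implicit Types (s f : set V) (M N : set 'cV[int]_g) (h : 'M[int]_g).

Lemma qval_shift Q L (a : R) x : qval (Q + a *: L) x = qval Q x + a * qval L x.
Proof.
by rewrite /qval mulmxDr mulmxDl -scalemxAr -scalemxAl [LHS]mxE [X in _ + X]mxE.
Qed.

Lemma sqform_eq0 v : sqform R v = 0 -> v = 0.
Proof.
move=> /matrixP v0; apply/colP => i; have := v0 i i.
rewrite !mxE big_ord1 !mxE => /eqP; rewrite mulf_eq0 orbb intr_eq0.
by move/eqP.
Qed.

Lemma sqform_scale v w (c : R) : intvec R v = c *: intvec R w ->
  sqform R v = c ^+ 2 *: sqform R w.
Proof.
move=> vw; rewrite /sqform vw; have -> : (c *: intvec R w)^T = c *: (intvec R w)^T.
  by apply/matrixP => i j; rewrite !mxE.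
by rewrite -scalemxAr -scalemxAl scalerA.
Qed.

Lemma zcone_gen M v : M v -> zcone (R := R) M (sqform R v).
Proof. by move=> Mv; apply: cone_gen; exists v. Qed.

Lemma zcone_face M l : (forall v, M v -> 0 <= l (sqform R v)) ->
  [set X | zcone (R := R) M X /\ l X = 0] = zcone [set v | M v /\ l (sqform R v) = 0].
Proof.
move=> lM; rewrite /zcone cone_ker => [|_ [v Mv <-]]; last exact: lM.
congr cone; apply/seteqP; split=> [_ [[v Mv <-] lv]|_ [v [Mv lv] <-]].
  by exists v.
by split=> //; exists v.
Qed.

Lemma intvec_pm v w (c : R) : intvec R v = c *: intvec R w -> c ^+ 2 = 1 ->
  v = w \/ v = - w.
Proof.
move=> vw /eqP; rewrite sqrf_eq1 => /orP[] /eqP c1; [left|right]; apply: (@intvec_inj R).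
  by rewrite vw c1 scale1r.
by rewrite intvecN vw c1 scaleN1r.
Qed.

(** [sqform R v] spans an exposed ray of [s], so some [w] in [N] is a multiple [c v]. Minimality for
    the two forms gives [c^2 >= 1] and [c^2 <= 1]. Conditions on minimal vectors are thus conditions
    on the cone. *)
Lemma pres_uniq_sub s M N : pres s M -> pres s N -> M `<=` N.
Proof.
move=> pM pN v Mv; have [Q [m [pQ m0 Qm ME sM]]] := pM.
have [P [n [pP n0 Pn NE sN]]] := pN.
have v0 := pres_neq0 pM Mv.
have [l [lge lv lpar]] := @line_functional R g v v0.
have [w Nw lw] : exists2 w, N w & l (sqform R w) = 0.
  apply: contrapT => nw; have : zcone (R := R) [set w | N w /\ l (sqform R w) = 0] (sqform R v).
    rewrite -zcone_face // -sN; split=> //.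
    by rewrite sM; exact: zcone_gen.
  rewrite (_ : [set _ | _] = set0) ?zcone_set0; last first.
    by apply/seteqP; split=> // w [Nw lw]; apply: nw; exists w.
  by move/sqform_eq0 => ve; move/eqP: v0.
have [c wc] := lpar w lw.
have w0 := pres_neq0 pN Nw.
have c1 : c ^+ 2 = 1.
  have := zq_scale Q wc; have := zq_scale P wc.
  have := Qm w w0; have := Pn v v0.
  have [_ ->] : v != 0 /\ zq Q v = m by move: Mv; rewrite ME.
  have [_ ->] : w != 0 /\ zq P w = n by move: Nw; rewrite NE.
  move=> h1 h2 h3 h4; apply/eqP; rewrite eq_le; apply/andP; split.
    have : c ^+ 2 * n <= n by rewrite {2}h3 ler_wpM2l // sqr_ge0.
    by rewrite ger_pMl.
  by move: h2; rewrite h4 ler_pMl.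
case: (intvec_pm wc c1) => wE; first by rewrite -wE.
by rewrite -[v]opprK -wE; exact: presN pN _.
Qed.

Lemma pres_uniq s M N : pres s M -> pres s N -> M = N.
Proof.
by move=> pM pN; apply/seteqP; split; [exact: pres_uniq_sub pM pN|exact: pres_uniq_sub pN pM].
Qed.

(* The face of sigma[Q] cut out by l is sigma[Q + eps l] for small eps > 0. *)
Lemma pres_face s M l : pres s M -> (forall X, s X -> 0 <= l X) ->
  pres [set X | s X /\ l X = 0] [set v | M v /\ l (sqform R v) = 0].
Proof.
move=> [Q [m [pQ m0 Qm ME sE]]] lge.
have lM v : M v -> 0 <= l (sqform R v).
  by move=> Mv; apply: lge; rewrite sE; exact: zcone_gen.
have [L Ls LE] := scalar_matrix l.
have [K K0 KQ] := posdef_scalar_bound l pQ.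
have [d d0 dQ] := zq_gap m pQ.
(* Chosen so that [ep * K * (m + d) = d / 2]: a nonzero vector outside [M] has value at least
   [m + d], and still at least [m + d / 2] after the perturbation. *)
pose ep := d / (K * (m + d) *+ 2).
have md0 : 0 < m + d by rewrite addr_gt0.
have ep0 : 0 < ep by rewrite divr_gt0 // mulrn_wgt0 // mulr_gt0.
have epK : ep * K = d / ((m + d) *+ 2) by rewrite /ep; field; rewrite ?gt_eqF.
have epK1 : ep * K < 1.
  by rewrite epK ltr_pdivrMr ?mulrn_wgt0 // mul1r mulr2n; lra.
have low x : (1 - ep * K) * qval Q x <= qval (Q + ep *: L) x.
  rewrite qval_shift LE.
  have := KQ x; rewrite ler_norml => /andP[+ _].
  by rewrite -(ler_pM2l ep0) mulrBl; lra.
have zE v : zq (Q + ep *: L) v = zq Q v + ep * l (sqform R v).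
  by rewrite /zq qval_shift LE.
have far v : v != 0 -> ~ M v -> m < zq (Q + ep *: L) v.
  move=> v0 nMv; have mv : m < zq Q v.
    rewrite lt_neqAle Qm // andbT; apply/eqP => mv; apply: nMv.
    by rewrite ME.
  apply: lt_le_trans (low _); apply: (@lt_le_trans _ _ ((1 - ep * K) * (m + d))).
    rewrite mulrBl mul1r epK.
    have -> : d / ((m + d) *+ 2) * (m + d) = d / 2 by field; rewrite ?gt_eqF.
    lra.
  by rewrite ler_wpM2l ?dQ //; lra.
exists (Q + ep *: L), m; split=> //.
- split; first by rewrite linearD linearZ /= Ls; case: pQ => ->.
  move=> x x0; apply: lt_le_trans (low x); rewrite mulr_gt0 //; first lra.
  by case: pQ => _; apply.
- move=> v v0; have [Mv|/(far v v0)/ltW//] := pselect (M v).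
  by rewrite zE ler_wpDr ?Qm // mulr_ge0 ?lM // ltW.
- apply/seteqP; split=> v [].
    move=> Mv lv; split; first by move: Mv; rewrite ME => -[].
    by rewrite zE lv mulr0 addr0; move: Mv; rewrite ME => -[].
  move=> v0 vm; have [Mv|/(far v v0)] := pselect (M v); last by rewrite vm ltxx.
  split=> //; move: vm; rewrite zE; move: (Mv); rewrite ME => -[_ ->] /eqP.
  rewrite -subr_eq0 addrAC subrr add0r mulf_eq0 (gt_eqF ep0) /=.
  by move/eqP.
- by rewrite sE zcone_face.
Qed.

Lemma pres_is_face s M f : pres s M -> is_face f s ->
  exists2 N, pres f N & N `<=` M.
Proof.
move=> pM [l [lge ->]]; exists [set v | M v /\ l (sqform R v) = 0].
  exact: pres_face.
by move=> v [].
Qed.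

(** [induced_orientation] accepts only ray generators as added vectors; this supplies them. *)
Lemma pres_ray s M v : pres s M -> M v -> ray_generator s (sqform R v).
Proof.
move=> pM Mv; have v0 := pres_neq0 pM Mv.
have [Q [m [pQ m0 Qm ME sE]]] := pM.
have [l [lge lv lpar]] := @line_functional R g v v0.
have sv : s (sqform R v) by rewrite sE; exact: zcone_gen.
exists [set X | s X /\ l X = 0]; split=> //.
- exists l; split=> // X; rewrite sE; apply: cone_scalar_ge0.
  by move=> _ [w _ <-].
- rewrite sE zcone_face // /cone_dim lspan_cone.
  have -> : lspan [set sqform R w | w in [set w | M w /\ l (sqform R w) = 0]] =
      <[sqform R v]>%VS.
    apply/eqP; rewrite eqEsubv -memvE mem_lspan ?andbT; last by exists v.
    apply: lspan_subv => _ [w [_ /lpar[c wc]] <-].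
    by rewrite (sqform_scale wc) memvZ // memv_line.
  by rewrite dim_vline; case: eqP => // /sqform_eq0 /eqP; rewrite (negPf v0).
- by apply/eqP => /sqform_eq0 /eqP; rewrite (negPf v0).
Qed.

End Presentations.

(** * Integral functionals *)

Section Dot.
Variable g : nat.
Implicit Types (phi psi : 'rV[int]_g) (v w u : 'cV[int]_g) (M : set 'cV[int]_g).

Definition dot phi v : int := (phi *m v) 0 0.

Lemma dotDl phi psi v : dot (phi + psi) v = dot phi v + dot psi v.
Proof. by rewrite /dot mulmxDl mxE. Qed.

Lemma dotZl (c : int) phi v : dot (c *: phi) v = c * dot phi v.
Proof. by rewrite /dot -scalemxAl mxE. Qed.

Lemma dotDr phi v w : dot phi (v + w) = dot phi v + dot phi w.
Proof. by rewrite /dot mulmxDr mxE. Qed.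

Lemma dotZr (c : int) phi v : dot phi (c *: v) = c * dot phi v.
Proof. by rewrite /dot -scalemxAr mxE. Qed.

Lemma dotNr phi v : dot phi (- v) = - dot phi v.
Proof. by rewrite /dot mulmxN mxE. Qed.

Lemma dot0r phi : dot phi 0 = 0.
Proof. by rewrite /dot mulmx0 mxE. Qed.

Lemma mul_outer v phi w : v *m phi *m w = dot phi w *: v.
Proof. by rewrite -mulmxA [phi *m w]mx11_scalar mul_mx_scalar. Qed.

Lemma mulmx_ext (A B : 'M[int]_g) : (forall v, A *m v = B *m v) -> A = B.
Proof.
move=> e; apply/matrixP => i j; have := e (delta_mx j 0).
by rewrite -!colE => /colP /(_ i); rewrite !mxE.
Qed.

(** Equivalently, Z^g is the direct sum of ker phi and Z v, with [M] inside ker phi. *)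
Definition splits M phi v : Prop := dot phi v = 1 /\ forall w, M w -> dot phi w = 0.

(** The map is [u + phi(u) (w - v)]. As [p] is an inverse of phi(w), the map [u + p phi(u) (v - w)]
    inverts it. *)
Lemma transvection_unit phi v w (p : int) : dot phi v = 1 -> p * dot phi w = 1 ->
  exists2 h : 'M[int]_g, h \in unitmx &
    h *m v = w /\ forall u, dot phi u = 0 -> h *m u = u.
Proof.
move=> fv fw; pose t (x : 'cV[int]_g) : 'M[int]_g := 1%:M + x *m phi.
have tE x u : t x *m u = u + dot phi u *: x by rewrite mulmxDl mul1mx mul_outer.
exists (t (w - v)); last first.
  split=> [|u fu]; first by rewrite tE fv scale1r addrC subrK.
  by rewrite tE fu scale0r addr0.
have : t (p *: (v - w)) *m t (w - v) = 1%:M.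
  apply: mulmx_ext => u; rewrite mul1mx -mulmxA !tE !(dotDr, dotZr, dotNr) fv.
  move: (dot phi u) => a; apply/colP => i; rewrite !mxE.
  transitivity (u i 0 + (1 - p * dot phi w) * (a * (w i 0 - v i 0))); first by ring.
  by rewrite fw; ring.
by case/mulmx1_unit.
Qed.

End Dot.

Lemma int_row_normal g (phi : 'rV[int]_g.+1) :
  exists (c : int) (A : 'M[int]_g.+1), A \in unitmx /\ phi = c *: row 0 A.
Proof.
have [L uL [A uA [d _ phiE]]] := int_Smith_normal_form phi.
exists (L 0 0 * (d`_0)), A; split=> //; rewrite {1}phiE.
apply/rowP => j; rewrite !mxE (bigD1 0) //= big1 ?addr0; last first.
  move=> i i0; rewrite !mxE big_ord1 !mxE /=.
  by rewrite (_ : (0%N == i) = false) ?mulr0 ?mul0r // eq_sym; apply: negPf.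
by rewrite !mxE big_ord1 !mxE eqxx mulr1n.
Qed.

Lemma dot_primitive g (phi : 'rV[int]_g) : phi != 0 ->
  exists (c : int) (psi : 'rV[int]_g) (u : 'cV[int]_g),
    [/\ c != 0, phi = c *: psi & dot psi u = 1].
Proof.
case: g phi => [|g] phi phi0; first by case/eqP: phi0; apply/rowP => -[].
have [c [A [uA phiE]]] := int_row_normal phi.
exists c, (row 0 A), (col 0 (invmx A)); split=> //.
  by apply: contra phi0 => /eqP c0; rewrite phiE c0 scale0r.
by rewrite /dot colE mulmxA -row_mul mulmxV // -colE !mxE.
Qed.

(** * Two complements are conjugate under GL_g(Z) *)

Section Splits.
Variable g : nat.
Implicit Types (phi psi : 'rV[int]_g) (v w u : 'cV[int]_g) (M : set 'cV[int]_g).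

(* The change of basis from v, u to a v + b u, - c v + p u in the plane that is
   complementary to the common kernel of phi and psi. *)
Lemma plane_unit phi psi v u (a b c p : int) :
  dot phi v = 1 -> dot phi u = 0 -> dot psi v = 0 -> dot psi u = 1 ->
  a * p + b * c = 1 ->
  exists2 h : 'M[int]_g, h \in unitmx &
    [/\ h *m v = a *: v + b *: u, h *m u = - c *: v + p *: u &
        forall w, dot phi w = 0 -> dot psi w = 0 -> h *m w = w].
Proof.
move=> fv fu pv pu apbc.
pose t (x y : 'cV[int]_g) : 'M[int]_g := 1%:M + (x - v) *m phi + (y - u) *m psi.
have tE x y w : t x y *m w = w + dot phi w *: (x - v) + dot psi w *: (y - u).
  by rewrite mulmxDl [(1%:M + _) *m w]mulmxDl mul1mx !mul_outer.
exists (t (a *: v + b *: u) (- c *: v + p *: u)); last first.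
  split=> [||w fw pw]; rewrite tE ?fv ?fu ?pv ?pu ?fw ?pw !(scale1r, scale0r, addr0) //.
  - by rewrite addrC subrK.
  - by rewrite addrC subrK.
have : t (p *: v - b *: u) (c *: v + a *: u) *m
       t (a *: v + b *: u) (- c *: v + p *: u) = 1%:M.
  apply: mulmx_ext => w; rewrite mul1mx -mulmxA !tE.
  rewrite !(dotDr, dotZr, dotNr, fv, fu, pv, pu).
  move: (dot phi w) (dot psi w) => x y.
  apply/colP => i; rewrite !mxE.
  transitivity (w i 0 + (a * p + b * c - 1) * (x * v i 0 + y * u i 0)); first by ring.
  by rewrite apbc; ring.
by case/mulmx1_unit.
Qed.

(** Since phi and psi may differ, one transvection need not suffice. Write psi = p phi + c chi with
    chi primitive and chi(v) = 0, and take u with phi(u) = 0, chi(u) = 1. A move in the plane of v,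
    u sends v to the component [a v + b u] of w; the equation psi(w) = 1 reads [a p + b c = 1],
    which is the unimodularity of that move. A transvection along psi then reaches w. Both moves fix
    the common kernel of phi and psi, which contains [M]. *)
Lemma splits_conj M phi v psi w : splits M phi v -> splits M psi w ->
  exists2 h : 'M[int]_g, h \in unitmx &
    h *m v = w /\ forall u, M u -> h *m u = u.
Proof.
move=> [fv fM] [pw pM]; pose p := dot psi v.
have [chi0|chi0] := eqVneq (psi - p *: phi) 0.
  have psiE : psi = p *: phi by apply/eqP; rewrite -subr_eq0 chi0.
  have pfw : p * dot phi w = 1 by rewrite -dotZl -psiE.
  have [h uh [hv hM]] := transvection_unit fv pfw.
  by exists h => //; split=> // u /fM /hM.
have [c [chi [u0 [c0 chiE chiu0]]]] := dot_primitive chi0.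
have psiE : psi = c *: chi + p *: phi by rewrite -chiE subrK.
have chiv : dot chi v = 0.
  have : c * dot chi v = 0.
    by rewrite -dotZl -chiE dotDl -scaleNr dotZl fv /p mulr1 subrr.
  by move/eqP; rewrite mulf_eq0 (negPf c0) => /eqP.
pose u := u0 - dot phi u0 *: v.
have fu : dot phi u = 0 by rewrite dotDr dotNr dotZr fv mulr1 subrr.
have chiu : dot chi u = 1 by rewrite dotDr dotNr dotZr chiv mulr0 subr0.
clearbody u.
pose a := dot phi w; pose b := dot chi w.
have ab : a * p + b * c = 1.
  by rewrite -pw psiE dotDl !dotZl /a /b; ring.
have [h uh [hv _ hM]] := plane_unit fv fu chiv chiu ab.
have psiv1 : dot psi (a *: v + b *: u) = 1.
  by rewrite psiE !(dotDl, dotZl, dotDr, dotZr) chiv chiu fv fu -[RHS]ab; ring.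
have [k uk [kv kM]] := transvection_unit psiv1 (etrans (mul1r _) pw).
exists (k *m h); first by rewrite unitmx_mul uk uh.
split=> [|x Mx]; rewrite -mulmxA ?hv //.
have chix : dot chi x = 0.
  have : c * dot chi x = 0.
    by rewrite -dotZl -chiE dotDl -scaleNr dotZl fM // pM // mulr0 addr0.
  by move/eqP; rewrite mulf_eq0 (negPf c0) => /eqP.
by rewrite hM ?fM // kM // pM.
Qed.
End Splits.

(** * The action of GL_g(Z) *)

Lemma lspan_image (F : realFieldType) (V : vectType F) (f : {linear V -> V})
    (s : set V) (b : seq V) : injective f ->
  basis_of (lspan s) b -> basis_of (lspan (f @` s)) (map f b).
Proof.
move=> fI bs; rewrite /basis_of (free_map_inj fI (basis_free bs)) andbT.
have -> : map f b = map (linfun f) b by apply: eq_map => x; rewrite lfunE.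
rewrite -limg_span (span_basis bs) eqEsubv; apply/andP; split.
  apply/subvP => _ /memv_imgP[x xs ->].
  have : (lspan s <= linfun f @^-1: lspan (f @` s))%VS.
    apply: lspan_subv => y sy; rewrite -memv_preim lfunE.
    by apply: mem_lspan; exists y.
  by move/subvP/(_ x xs); rewrite -memv_preim.
apply: lspan_subv => _ [x sx <-]; rewrite -(lfunE f); apply: memv_img.
exact: mem_lspan.
Qed.

Section Action.
Variables (R : realType) (g : nat).
Notation V := 'M[R]_g.
Implicit Types (h k : 'M[int]_g) (X : V) (s f : set V) (M : set 'cV[int]_g).

Lemma glact_is_linear h : linear (@glact R g h).
Proof.
by move=> a X Y; rewrite /glact mulmxDr mulmxDl -scalemxAr -scalemxAl.
Qed.

HB.instance Definition _ h := GRing.isLinear.Build R V V *:%R (@glact R g h)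
  (glact_is_linear h).

Lemma glactM h k X : glact h (glact k X) = glact (h *m k) X.
Proof. by rewrite /glact map_mxM /= trmx_mul !mulmxA. Qed.

Lemma glact1 X : glact 1%:M X = X.
Proof. by rewrite /glact map_mx1 trmx1 mulmx1 mul1mx. Qed.

Lemma glactK h : h \in unitmx -> cancel (@glact R g h) (glact (invmx h)).
Proof. by move=> uh X; rewrite glactM mulVmx // glact1. Qed.

Lemma glactVK h : h \in unitmx -> cancel (@glact R g (invmx h)) (glact h).
Proof. by move=> uh X; rewrite glactM mulmxV // glact1. Qed.

Lemma glact_inj h : h \in unitmx -> injective (@glact R g h).
Proof. by move/glactK/can_inj. Qed.

Lemma hactM h k s : glact h @` (glact k @` s) = glact (h *m k) @` s.
Proof.
rewrite image_comp; apply: eq_imagel => X _ /=; exact: glactM.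
Qed.

Lemma hact1 s : glact 1%:M @` s = s.
Proof.
by apply/seteqP; split=> [_ [X sX <-]|X sX]; [|exists X => //]; rewrite glact1.
Qed.

Lemma hactK h s : h \in unitmx -> glact (invmx h) @` (glact h @` s) = s.
Proof. by move=> uh; rewrite hactM mulVmx // hact1. Qed.

Lemma hactVK h s : h \in unitmx -> glact h @` (glact (invmx h) @` s) = s.
Proof. by move=> uh; rewrite hactM mulmxV // hact1. Qed.

Lemma unitmxV h : h \in unitmx -> invmx h \in unitmx.
Proof. by rewrite unitmx_inv. Qed.

Lemma basis_act h s b : h \in unitmx ->
  basis_of (lspan s) b -> basis_of (lspan (glact h @` s)) (map (glact h) b).
Proof. by move=> uh; apply: lspan_image; exact: glact_inj. Qed.

Lemma cone_dim_act h s : h \in unitmx -> cone_dim (glact h @` s) = cone_dim s.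
Proof.
move=> uh; have bs := lbasisP s.
by rewrite /cone_dim -(basis_size (basis_act uh bs)) size_map (basis_size bs).
Qed.

Lemma ors_act h s b c : h \in unitmx -> basis_of (lspan s) b ->
  basis_of (lspan s) c -> ors (map (glact h) b) (map (glact h) c) = ors b c.
Proof.
move=> uh bs cs; rewrite /ors (same_orientation_map _ bs cs) //.
exact: glact_inj.
Qed.

Lemma face_act h f s : h \in unitmx -> is_face f s ->
  is_face (glact h @` f) (glact h @` s).
Proof.
move=> uh [l [lge ->]].
have [m mE] : exists m : {scalar V}, forall X, m X = l (glact (invmx h) X).
  by apply: scalar_of_fun => a X Y; rewrite !linearP.
exists m; split=> [_ [X sX <-]|]; first by rewrite mE glactK // lge.
apply/seteqP; split=> [_ [X [sX lX] <-]|_ [[X sX <-]]].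
  by split; [exists X|rewrite mE glactK].
by rewrite mE glactK // => lX; exists X.
Qed.

Lemma facet_act h f s : h \in unitmx -> is_facet f s ->
  is_facet (glact h @` f) (glact h @` s).
Proof.
move=> uh [fs df]; split; first exact: face_act.
by rewrite !cone_dim_act.
Qed.

Lemma infl_act h s X : glact h @` infl s X = infl (glact h @` s) (glact h X).
Proof.
apply/seteqP; split=> [_ [_ [Y [t [sY t0 ->]]] <-]|_ [_ [t [[Y sY <-] t0 ->]]]].
  by exists (glact h Y), t; rewrite linearD linearZ; split=> //; exists Y.
by exists (Y + t *: X); [exists Y, t|rewrite linearD linearZ].
Qed.

Lemma intvecM h v : intvec R (h *m v) = map_mx intr h *m intvec R v.
Proof. exact: map_mxM. Qed.

Lemma glact_sqform h v : glact h (sqform R v) = sqform R (h *m v).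
Proof. by rewrite /glact /sqform intvecM trmx_mul !mulmxA. Qed.

Lemma zcone_act h M : glact h @` zcone (R := R) M = zcone [set h *m v | v in M].
Proof.
rewrite /zcone cone_image; congr cone.
apply/seteqP; split=> [_ [_ [v Mv <-] <-]|_ [_ [v Mv <-] <-]].
  by exists (h *m v); [exists v|exact/esym/glact_sqform].
by exists (sqform R v); [exists v|exact: glact_sqform].
Qed.

Lemma pres_act h s M : h \in unitmx -> pres s M ->
  pres (glact h @` s) [set h *m v | v in M].
Proof.
move=> uh [Q [m [pQ m0 Qm ME sE]]].
pose H : V := map_mx intr (invmx h).
pose P := H^T *m Q *m H.
have PE x : qval P x = qval Q (H *m x) by rewrite /qval trmx_mul !mulmxA.
have zE v : zq P v = zq Q (invmx h *m v) by rewrite /zq PE intvecM.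
have inj0 v : (invmx h *m v == 0) = (v == 0).
  apply/eqP/eqP => [v0|->]; last exact: mulmx0.
  by rewrite -[v](mulKVmx uh) v0 mulmx0.
exists P, m; split=> //.
- split; first by rewrite /P !trmx_mul trmxK mulmxA; case: pQ => ->.
  move=> x x0; rewrite PE; case: pQ => _; apply; apply: contra x0 => /eqP Hx.
  have : map_mx intr h *m (H *m x) = x.
    by rewrite mulmxA -map_mxM /= mulmxV // map_mx1 mul1mx.
  by rewrite Hx mulmx0 => <-.
- by move=> v v0; rewrite zE Qm // inj0.
- rewrite ME; apply/seteqP; split=> [_ [v [v0 vm] <-]|v [v0 vm]].
    by rewrite /= zE mulKmx // -inj0 mulKmx.
  by exists (invmx h *m v); [rewrite /= inj0 -zE|rewrite mulKVmx].
- by rewrite sE zcone_act.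
Qed.

End Action.

(** * Inflations of perfect cones are perfect *)

Section SplitCones.
Variables (R : realType) (g : nat).
Notation V := 'M[R]_g.
Implicit Types (h k : 'M[int]_g) (X : V) (s f : set V) (M : set 'cV[int]_g).
Implicit Types (phi : 'rV[int]_g) (v w : 'cV[int]_g).

(** It serves twice: to separate the apex from [s], and to cut out of a cone with a coloop the face
    that lies over ker phi. *)
Lemma dot_scalar phi : exists l : {scalar V},
  forall v, l (sqform R v) = ((dot phi v)%:~R) ^+ 2.
Proof.
pose p : 'rV[R]_g := map_mx intr phi.
have [l lE] : exists l : {scalar V}, forall X, l X = (p *m X *m p^T) 0 0.
  apply: scalar_of_fun => a X Y.
  by rewrite mulmxDr mulmxDl -scalemxAr -scalemxAl [LHS]mxE [X in X + _]mxE.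
exists l => v; rewrite lE /sqform mulmxA -mulmxA mxE big_ord1 expr2.
have pv : p *m intvec R v = map_mx intr (phi *m v) by rewrite map_mxM.
have -> : (intvec R v)^T *m p^T = (p *m intvec R v)^T by rewrite trmx_mul.
have E : (p *m intvec R v) 0 0 = (dot phi v)%:~R by rewrite pv mxE.
by rewrite [X in _ * X]mxE E.
Qed.

Lemma zcone_scalar_eq0 M (l : {scalar V}) X :
  (forall v, M v -> l (sqform R v) = 0) -> zcone M X -> l X = 0.
Proof.
move=> lM; apply: (@cone_min R V _ (fun X => l X = 0)) => [|Y Z lY lZ|t _ t0 [v Mv <-]].
- exact: linear0.
- by rewrite linearD lY lZ addr0.
- by rewrite linearZ /= lM // mulr0.
Qed.

Lemma zcone_infl M v : infl (zcone (R := R) M) (sqform R v) =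
  zcone (M `|` [set v; - v]).
Proof.
apply/seteqP; split=> [_ [X [t [MX t0 ->]]]|].
  apply: coneD; last by apply: coneZ => //; apply: zcone_gen; right; left.
  by apply: coneS MX => _ [w Mw <-]; exists w => //; left.
apply: cone_min => [|_ _ [X [t [MX t0 ->]]] [Y [u [MY u0 ->]]]|t X t0 [w Mw <-]].
- by apply: infl_sub; exact: cone0.
- by exists (X + Y), (t + u); rewrite addr_ge0 // scalerDl addrACA; split=> //; exact: coneD.
- case: Mw => [Mw|wv].
    by apply: infl_sub; apply: coneZ => //; exact: zcone_gen.
  exists 0, t; rewrite add0r; split=> //; first exact: cone0.
  by case: wv => ->; rewrite ?sqformN.
Qed.

(** At [w] the inflated form is [Q(w - phi(w) v) + m phi(w)^2]. If phi(w) = 0 this is [Q(w)].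
    Otherwise phi(w) is a nonzero integer and the value is at least [m], with equality only for
    [w = v] and [w = - v]. *)
Lemma pres_infl s M phi v : pres s M -> splits M phi v ->
  pres (infl s (sqform R v)) (M `|` [set v; - v]).
Proof.
move=> [Q [m [pQ m0 Qm ME sE]]] [fv fM].
pose p : 'rV[R]_g := map_mx intr phi; pose y := intvec R v.
have E w : (p *m intvec R w) 0 0 = (dot phi w)%:~R.
  by rewrite /p /intvec -map_mxM mxE.
pose P : V := 1%:M - y *m p.
pose Q' := P^T *m Q *m P + m *: (p^T *m p).
have Q'E x : qval Q' x = qval Q (P *m x) + m * ((p *m x) 0 0) ^+ 2.
  rewrite qval_shift; congr (_ + _ * _); first by rewrite /qval trmx_mul !mulmxA.
  rewrite /qval mulmxA -trmx_mul -mulmxA mxE big_ord1 expr2; congr (_ * _).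
  by rewrite mxE.
have PE x : P *m x = x - (p *m x) 0 0 *: y.
  by rewrite mulmxBl mul1mx -mulmxA {1}[p *m x]mx11_scalar mul_mx_scalar.
have zE w : zq Q' w = zq Q (w - dot phi w *: v) + m * ((dot phi w)%:~R) ^+ 2.
  rewrite /zq Q'E PE E; congr (qval Q _ + _).
  by apply/colP => i; rewrite !mxE rmorphB rmorphM.
have far w : dot phi w != 0 -> m <= m * ((dot phi w)%:~R) ^+ 2 /\
    (m * ((dot phi w)%:~R) ^+ 2 = m -> dot phi w = 1 \/ dot phi w = -1).
  move=> fw; split.
    rewrite ler_pMr // -rmorphXn /= -[1]/(1%:~R) ler_int; nia.
  move=> e; have /eqP : ((dot phi w)%:~R) ^+ 2 = 1 :> R.
    by apply: (mulfI (lt0r_neq0 m0)); rewrite e mulr1.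
  by rewrite sqrf_eq1 -[X in _ == X]/(1%:~R) -[X in _ || (_ == - X)]/(1%:~R) -mulrNz !eqr_int
    => /orP[] /eqP; [left|right].
have zge0 w : 0 <= zq Q w by exact: posdef_ge0.
exists Q', m; split=> //.
- split.
    rewrite linearD linearZ /= !trmx_mul !trmxK mulmxA.
    by case: pQ => ->.
  move=> x x0; rewrite Q'E; have [Px|Px] := eqVneq (P *m x) 0.
    have px : (p *m x) 0 0 != 0.
      apply: contra x0 => /eqP px; move: Px; rewrite PE px scale0r subr0.
      by move=> ->.
    by rewrite Px /qval mulmx0 mxE add0r mulr_gt0 // exprn_even_gt0.
  rewrite ltr_pwDl //; first by case: pQ => _; apply.
  by rewrite mulr_ge0 ?sqr_ge0 // ltW.
- move=> w w0; rewrite zE; have [fw|/far[fw _]] := eqVneq (dot phi w) 0.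
    by rewrite fw scale0r subr0 expr0n mulr0 addr0 Qm.
  by apply: le_trans fw _; rewrite lerDr.
- apply/seteqP; split=> w.
    case=> [Mw|[]->].
    + rewrite /= zE fM // scale0r subr0 expr0n mulr0 addr0.
      by move: Mw; rewrite ME.
    + rewrite /= zE fv scale1r subrr /zq intvec0 /qval mulmx0 mxE add0r expr1n mulr1.
      by split=> //; apply/eqP => v0; move: fv; rewrite v0 dot0r.
    + rewrite /= zqN zE fv scale1r subrr /zq intvec0 /qval mulmx0 mxE add0r expr1n mulr1.
      by split=> //; rewrite oppr_eq0; apply/eqP => v0; move: fv; rewrite v0 dot0r.
  move=> [w0]; rewrite zE; have [fw|/far[fw f1]] := eqVneq (dot phi w) 0.
    by rewrite fw scale0r subr0 expr0n mulr0 addr0 => wm; left; rewrite ME.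
  move=> wm; right; move: (zge0 (w - dot phi w *: v)) => z0.
  have zz : zq Q (w - dot phi w *: v) = 0 by apply/eqP; rewrite eq_le z0 andbT; lra.
  have wv : w = dot phi w *: v.
    apply/eqP; rewrite -subr_eq0; apply/negPn/negP => /Qm.
    by rewrite zz => /(lt_le_trans m0); rewrite ltxx.
  have [fw1|fw1] : dot phi w = 1 \/ dot phi w = -1 by apply: f1; lra.
    by left; rewrite wv fw1 scale1r.
  by right; rewrite wv fw1 scaleN1r.
- by rewrite sE zcone_infl.
Qed.

End SplitCones.

(** * Rank and coloops *)

Lemma mulmx_colV n (A : 'M[int]_n) j : A \in unitmx ->
  A *m col j (invmx A) = delta_mx j 0.
Proof. by move=> uA; rewrite colE mulKVmx. Qed.

(** With phi a multiple of the first row of a unimodular [A], the columns of [invmx A] after the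
    first form a basis of ker phi, and [v] completes it. This is the basis that [Zcoloop] asks
    for. *)
Lemma Zbasis_of_dot g (phi : 'rV[int]_g) v : dot phi v = 1 ->
  exists (w : 'I_g -> 'cV[int]_g) (k : 'I_g),
  [/\ Zbasis w, w k = v & forall x, dot phi x = 0 ->
    exists a : 'I_g -> int, x = \sum_(i | i != k) a i *: w i].
Proof.
case: g phi v => [|g'] phi v fv; first by move: fv; rewrite /dot mxE big_ord0.
have [c [A [uA phiE]]] := int_row_normal phi.
pose w (j : 'I_g'.+1) := if j == 0 then v else col j (invmx A).
have phix x : dot phi x = c * (A *m x) 0 0.
  by rewrite phiE dotZl /dot -row_mul mxE.
have c0 : c != 0 by apply/eqP => c0; move: fv; rewrite phix c0 mul0r.
have ker x : dot phi x = 0 -> x = \sum_(i | i != 0) (A *m x) i 0 *: w i.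
  rewrite phix => /eqP; rewrite mulf_eq0 (negPf c0) => /eqP x0.
  rewrite -{1}[x](mulKmx uA); set y := A *m x in x0 *.
  transitivity (\sum_i y i 0 *: col i (invmx A)).
    apply/colP => i; rewrite summxE mxE; apply: eq_bigr => j _.
    by rewrite !mxE mulrC.
  rewrite (bigD1 0) //= x0 scale0r add0r; apply: eq_bigr => i i0.
  by rewrite /w (negPf i0).
have dw i : i != 0 -> dot phi (w i) = 0.
  move=> i0; rewrite /w (negPf i0) phix mulmx_colV // !mxE.
  by rewrite [0 == i]eq_sym (negPf i0) mulr0.
have fsum (a : 'I_g'.+1 -> int) : dot phi (\sum_i a i *: w i) = a 0.
  rewrite (bigD1 0) //= dotDr dotZr {1}/w eqxx fv mulr1.
  rewrite (_ : dot phi (\sum_(i | _) _) = 0) ?addr0 //.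
  apply: (big_ind (fun u => dot phi u = 0)) => [|u u' hu hu'|i ik].
  - exact: dot0r.
  - by rewrite dotDr hu hu' addr0.
  - by rewrite dotZr dw // mulr0.
have coord (a : 'I_g'.+1 -> int) j : j != 0 ->
    (A *m (\sum_i a i *: w i - a 0 *: v)) j 0 = a j.
  move=> j0; rewrite (bigD1 0) //= {1}/w eqxx addrAC subrr add0r mulmx_sumr summxE.
  rewrite (bigD1 j) //= big1 => [|i /andP[i0 ij]]; rewrite /w.
    by rewrite (negPf j0) -scalemxAr mulmx_colV // !mxE eqxx mulr1 addr0.
  rewrite (negPf i0) -scalemxAr mulmx_colV // !mxE.
  by rewrite [j == i]eq_sym (negPf ij) mulr0.
exists w, 0; split; last by move=> x fx; exists (fun i => (A *m x) i 0); exact: ker.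
  move=> x; exists [ffun i => if i == 0 then dot phi x else
    (A *m (x - dot phi x *: v)) i 0]; split.
    rewrite (bigD1 0) //= ffunE eqxx {1}/w eqxx -[LHS](subrK (dot phi x *: v)) addrC.
    congr (_ + _); rewrite {1}(ker (x - dot phi x *: v)).
      by apply: eq_bigr => i i0; rewrite ffunE (negPf i0).
    by rewrite dotDr dotNr dotZr fv mulr1 subrr.
  move=> a ->; apply/ffunP => i; rewrite ffunE fsum.
  by case: eqVneq => [->//|i0]; rewrite coord.
by rewrite /w eqxx.
Qed.

Section ConeRank.
Variables (R : realType) (g : nat).
Notation V := 'M[R]_g.
Implicit Types (h k : 'M[int]_g) (X : V) (s f : set V) (M : set 'cV[int]_g).
Implicit Types (phi : 'rV[int]_g) (v w : 'cV[int]_g).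

Definition low_cone s := exists M phi v, pres s M /\ splits M phi v.

(** [v] need not be minimal; when it is not, the condition is that of [low_cone]. So both
    alternatives of [inflation_cone] are covered. *)
Definition coloop_cone s := exists M phi v, [/\ pres s M, dot phi v = 1 &
  forall w, M w -> dot phi w = 0 \/ w = v \/ w = - v].

Lemma rank_le_cone_rank s X : s X -> (\rank X <= cone_rank s)%N.
Proof.
move=> sX; have rX : (\rank X < g.+1)%N by rewrite ltnS rank_leq_row.
rewrite -[\rank X]/(nat_of_ord (Ordinal rX)) /cone_rank.
by apply: (leq_bigmax_cond (F := fun r : 'I_g.+1 => r : nat)); apply/asboolP; exists X.
Qed.

Lemma cone_rank_le s : (cone_rank s <= g)%N.
Proof. by apply/bigmax_leqP => r _; rewrite -ltnS. Qed.

Lemma sqform_qval (x : 'cV[R]_g) v :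
  qval (sqform R v) x = ((x^T *m intvec R v) 0 0) ^+ 2.
Proof.
rewrite /qval /sqform mulmxA -mulmxA mxE big_ord1 expr2; congr (_ * _).
have -> : (intvec R v)^T *m x = (x^T *m intvec R v)^T by rewrite trmx_mul trmxK.
by rewrite mxE.
Qed.

Lemma qval_sum (I : Type) (r : seq I) (F : I -> V) (x : 'cV[R]_g) :
  qval (\sum_(i <- r) F i) x = \sum_(i <- r) qval (F i) x.
Proof. by rewrite /qval mulmx_sumr mulmx_suml summxE. Qed.

(** The sum of [v v^T] over all minimal vectors is singular, and a real vector in its kernel is
    orthogonal to each of them. Smith normal form replaces it by an integral functional that takes
    the value 1. *)
Lemma low_rank s M : (0 < g)%N -> pres s M -> (cone_rank s <= g - 1)%N -> low_cone s.
Proof.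
move=> g0 pM rs; have [r rE] := (finite_seqP _).1 (pres_finite pM).
pose X := \sum_(v <- r) sqform R v.
have sX : s X.
  have [Q [m [_ _ _ _ ->]]] := pM.
  rewrite /X big_seq; apply: (big_ind (fun X => zcone M X)).
  - exact: cone0.
  - by move=> *; exact: coneD.
  - by move=> v vr; apply: zcone_gen; rewrite rE.
have : ~~ row_free X.
  by rewrite /row_free neq_ltn; have := rank_le_cone_rank sX; lia.
rewrite -kermx_eq0 => /rowV0Pn[u /sub_kermxP uX u0].
have uv v : v \in r -> u *m intvec R v = 0.
  move=> vr; have : qval X u^T = 0 by rewrite /qval trmxK uX mul0mx mxE.
  rewrite /X qval_sum => /eqP; rewrite psumr_eq0 => [/allP/(_ v vr)|w _]; last first.
    by rewrite sqform_qval sqr_ge0.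
  rewrite sqform_qval trmxK /= sqrf_eq0 => /eqP e.
  by rewrite [LHS]mx11_scalar e; apply/matrixP => a b; rewrite !mxE mul0rn.
(* The rows of [A] are the minimal vectors. In its Smith form [L D B] the diagonal matrix [D] kills
   [B u^T], which is nonzero in some coordinate [j]; so column [j] of [D] is zero. *)
pose A : 'M[int]_(size r, g) := \matrix_(i, j) (nth 0 r i) j 0.
have [L uL [B uB [d _ AE]]] := int_Smith_normal_form A.
pose D : 'M[int]_(size r, g) := \matrix_(i, j) (d`_i *+ (i == j :> nat)).
have AE' : A = L *m D *m B by [].
have Au : map_mx intr A *m u^T = 0.
  apply/colP => i; rewrite !mxE.
  have /matrixP/(_ 0 0) := uv (nth 0 r i) (mem_nth _ (ltn_ord i)).
  rewrite !mxE => e; rewrite -[RHS]e; apply: eq_bigr => j _; rewrite !mxE; exact: mulrC.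
pose y : 'cV[R]_g := map_mx intr B *m u^T.
have Dy : map_mx intr D *m y = 0.
  have LL : map_mx intr (invmx L) *m map_mx (intr : int -> R) L = 1%:M.
    by rewrite -map_mxM /= mulVmx // map_mx1.
  rewrite -[LHS]mul1mx -LL -mulmxA.
  have -> : map_mx intr L *m (map_mx intr D *m y) = map_mx intr A *m u^T.
    by rewrite AE' !map_mxM /= /y !mulmxA.
  by rewrite Au mulmx0.
have [j yj] : exists j, y j 0 != 0.
  apply: contrapT => ny; move/negP: u0; apply.
  have y0 : y = 0.
    by apply/colP => j; rewrite [RHS]mxE; apply: contrapT => /eqP yj; apply: ny; exists j.
  rewrite -trmx_eq0; have -> : u^T = map_mx intr (invmx B) *m y.
    by rewrite /y mulmxA -map_mxM /= mulVmx // map_mx1 mul1mx.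
  by rewrite y0 mulmx0.
clearbody y.
have Dj i : D i j = 0.
  rewrite mxE; case: eqP => // ij; have /colP/(_ i) := Dy.
  rewrite !mxE (bigD1 j) //= big1 ?addr0 => [|k kj]; last first.
    by rewrite !mxE ij (_ : (_ == _) = false) ?mul0r //; apply/eqP => /val_inj e; case/eqP: kj.
  rewrite !mxE ij eqxx mulr1n => /eqP; rewrite mulf_eq0 (negPf yj) orbF intr_eq0.
  by move/eqP.
(* [A] kills this column, which therefore gives the functional; row [j] of [B] is a vector on which
   it equals 1. *)
pose z := col j (invmx B).
exists M, z^T, (row j B)^T; split=> //; split=> [|w].
  rewrite /dot -trmx_mul mxE /z colE mulmxA -row_mul mulmxV //.
  by rewrite -colE !mxE eqxx.
rewrite rE /= => wr; have iw : (index w r < size r)%N by rewrite index_mem.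
have Az : A *m z = 0.
  rewrite AE' -!mulmxA /z mulmx_colV // -colE.
  by apply/colP => i; rewrite !mxE big1 // => k _; rewrite [col _ _ _ _]mxE Dj mulr0.
have /colP/(_ (Ordinal iw)) := Az; rewrite [RHS]mxE /dot => e; rewrite -[RHS]e.
by rewrite !mxE; apply: eq_bigr => k _; rewrite !mxE /= nth_index // mulrC.
Qed.

(** Over the reals, phi is a nonzero vector in the kernel of every element of [s]. *)
Lemma rank_low s M phi v : pres s M -> splits M phi v -> (cone_rank s <= g - 1)%N.
Proof.
move=> pM [fv fM]; have [Q [m [_ _ _ _ sE]]] := pM.
pose p : 'rV[R]_g := map_mx intr phi.
have pM0 w : M w -> (intvec R w)^T *m p^T = 0.
  move=> Mw; rewrite -trmx_mul /p /intvec -map_mxM [phi *m w]mx11_scalar.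
  by rewrite -/(dot phi w) fM //; apply/matrixP => i j; rewrite !mxE mul0rn.
have Xp X : s X -> X *m p^T = 0.
  rewrite sE; apply: (@cone_min R V _ (fun X => X *m p^T = 0)) => [|Y Z hY hZ|t _ t0 [w Mw <-]].
  - exact: mul0mx.
  - by rewrite mulmxDl hY hZ addr0.
  - by rewrite -scalemxAl /sqform -mulmxA pM0 // mulmx0 scaler0.
apply/bigmax_leqP => r /asboolP[X sX rX].
suff : (r < g)%N by lia.
rewrite -rX ltn_neqAle rank_leq_row andbT; apply/negP => /eqP rg.
have uX : X \in unitmx by rewrite -row_free_unit /row_free rg.
have p0 : p = 0.
  by apply: trmx_inj; rewrite -[LHS](mulKmx uX) Xp // mulmx0 trmx0.
have phi0 : phi = 0.
  apply/rowP => i; have /rowP/(_ i) := p0; rewrite !mxE => /eqP.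
  by rewrite intr_eq0 => /eqP.
by move: fv; rewrite phi0 /dot mul0mx mxE.
Qed.

Lemma Zbasis_coord (w : 'I_g -> 'cV[int]_g) (k : 'I_g) : Zbasis w ->
  exists phi, forall i, dot phi (w i) = (i == k)%:R.
Proof.
move=> wb; pose W : 'M[int]_g := \matrix_(i, j) w j i 0.
have WE (a : 'cV[int]_g) : \sum_i a i 0 *: w i = W *m a.
  apply/colP => i; rewrite summxE mxE; apply: eq_bigr => j _.
  by rewrite !mxE mulrC.
have [A WA] : exists A : 'M[int]_g, W *m A = 1%:M.
  have /choice[a aE] : forall j : 'I_g, exists a : {ffun 'I_g -> int},
      delta_mx j 0 = \sum_i a i *: w i.
    by move=> j; have [a [aE _]] := wb (delta_mx j 0); exists a.
  exists (\matrix_(i, j) a j i); apply/matrixP => i j.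
  rewrite [RHS]mxE mxE; have := congr1 (fun u : 'cV[int]_g => u i 0) (aE j).
  rewrite summxE mxE eqxx andbT => ->.
  by apply: eq_bigr => l _; rewrite !mxE mulrC.
have [uW _] := mulmx1_unit WA.
exists (row k (invmx W)) => i.
have -> : w i = col i W by apply/colP => l; rewrite !mxE.
by rewrite /dot colE mulmxA -row_mul mulVmx // -colE !mxE eq_sym.
Qed.

Lemma has_coloop_cone s : has_coloop s -> coloop_cone s.
Proof.
move=> [Q [S [v [pQ sE [SM SN] [Sv [w [k [wb wk wS]]]]]]]].
have [phi phiE] := Zbasis_coord k wb.
exists (minvec Q), phi, v; split=> [||x Mx].
- by rewrite sE; apply: pres_sigma pQ (SM _ Sv).
- by rewrite -wk phiE eqxx.
have coord y : S y -> y <> v -> dot phi y = 0.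
  move=> Sy yv; have [a ->] := wS y Sy yv.
  apply: (big_ind (fun u => dot phi u = 0)) => [|u u' hu hu'|i ik].
  - exact: dot0r.
  - by rewrite dotDr hu hu' addr0.
  - by rewrite dotZr phiE (negPf ik) mulr0.
have [->|xv] := eqVneq x v; first by right; left.
have [->|xv'] := eqVneq x (- v); first by right; right.
left; have [Sx|nSx] := pselect (S x); first by apply: coord => //; exact/eqP.
have SNx : S (- x) by apply: contrapT => n; apply: nSx; apply/(SN x Mx).
by apply/eqP; rewrite -oppr_eq0 -dotNr coord // => /eqP; rewrite eqr_oppLR (negPf xv').
Qed.

Lemma coloop_cone_has s M phi v : pres s M -> dot phi v = 1 ->
  (forall w, M w -> dot phi w = 0 \/ w = v \/ w = - v) -> M v -> has_coloop s.
Proof.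
move=> pM fv fM Mv.
have [|Q [pQ sE QM]] := pres_minvec pM; first by exists v.
(* [rep] selects one vector of each pair [x], [- x], and [S] collects the selected minimal vectors.
   The selection may contain [- v] instead of [v], hence the two cases at the end. *)
pose rep (x : 'cV[int]_g) := xget 0 [set y | y = x \/ y = - x].
have repP x : rep x = x \/ rep x = - x.
  by apply: (@xgetPex _ 0 [set y | y = x \/ y = - x]); exists x; left.
have repN x : rep (- x) = rep x.
  congr (xget 0 _); apply/seteqP; rewrite opprK.
  by split=> y; case; [right|left|right|left].
pose S := [set x | M x /\ rep x = x].
have neqN x : M x -> - x <> x.
  move=> Mx e; case/eqP: (pres_neq0 pM Mx); apply/colP => i.
  by have /colP/(_ i) := e; rewrite !mxE => /eqP; rewrite eqNr => /eqP.
have half : half_minvec Q S.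
  rewrite /half_minvec QM; split=> [x []//|x Mx]; rewrite /S /= repN.
  split=> [[_ ->] [_ e]|nx]; first by apply: (neqN x Mx).
  split=> //; case: (repP x) => // e; case: nx; split=> //.
  exact: presN pM Mx.
have col psi u : dot psi u = 1 -> S u ->
    (forall w, M w -> dot psi w = 0 \/ w = u \/ w = - u) -> Zcoloop S u.
  move=> fu Su psiM; split=> //.
  have [w [k [wb wk wker]]] := Zbasis_of_dot fu.
  exists w, k; split=> // x [Mx xr] xu; apply: wker.
  case: (psiM x Mx) => // -[//|xE]; exfalso.
  by case: Su => Mu ur; apply: (neqN u Mu); rewrite -xE -xr xE repN ur.
exists Q, S; case: (repP v) => rv.
  by exists v; split=> //; exact: (col phi).
exists (- v); split=> //; apply: (col (- phi)).
- by rewrite /dot mulNmx mulmxN opprK.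
- by split; [exact: presN pM Mv|rewrite repN].
- move=> w Mw; case: (fM w Mw) => [fw|[->|->]].
  + by left; rewrite /dot mulNmx mxE -/(dot phi w) fw oppr0.
  + by right; right; rewrite opprK.
  + by right; left.
Qed.

Lemma inflation_coneP s : (0 < g)%N -> perfect_cone s ->
  inflation_cone s <-> coloop_cone s.
Proof.
move=> g0 ps; split=> [[rs|[_]]|[M [phi [v [pM fv fM]]]]].
- have [M pM] := perfect_pres ps; have [N [phi [v [pN [fv fN]]]]] := low_rank g0 pM rs.
  by exists N, phi, v; split=> // w Nw; left; exact: fN.
- exact: has_coloop_cone.
have [Mv|nMv] := pselect (M v).
  have hc := coloop_cone_has pM fv fM Mv.
  have := cone_rank_le s; rewrite leq_eqVlt => /orP[/eqP rs|rs]; first by right.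
  by left; lia.
left; apply: (rank_low pM); split; first exact: fv.
move=> w Mw; case: (fM w Mw) => // -[wv|wv]; exfalso; apply: nMv.
  by rewrite -wv.
by rewrite -[v]opprK -wv; exact: presN pM Mw.
Qed.

End ConeRank.

(** * The contracting homotopy *)

Section Forms.
Variables (R : realType) (g : nat).
Notation V := 'M[R]_g.
Notation cochain := (set V -> seq V -> rat).
Implicit Types (h k : 'M[int]_g) (X : V) (s f : set V) (M N : set 'cV[int]_g).
Implicit Types (phi psi : 'rV[int]_g) (v w : 'cV[int]_g) (b c : seq V) (F : cochain).

Definition is_form F : Prop :=
  (forall s, perfect_cone s -> alternates F s) /\
  (forall s h b, perfect_cone s -> h \in unitmx -> basis_of (lspan s) b ->
     F (glact h @` s) (map (glact h) b) = F s b).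

Lemma perfect_face s f : perfect_cone s -> is_face f s -> perfect_cone f.
Proof.
move=> /perfect_pres[M pM] /(pres_is_face pM)[N pN _]; exact: pres_perfect pN.
Qed.

Lemma perfect_facet s f : perfect_cone s -> is_facet f s -> perfect_cone f.
Proof. by move=> ps [fs _]; exact: perfect_face fs. Qed.

Lemma perfect_poly s : perfect_cone s -> poly_cone s.
Proof. by move=> /perfect_pres[M]; exact: pres_poly. Qed.

Lemma perfect_act s h : h \in unitmx -> perfect_cone s -> perfect_cone (glact h @` s).
Proof. by move=> uh /perfect_pres[M pM]; apply: pres_perfect (pres_act uh pM). Qed.

Lemma perfect0 s : perfect_cone s -> s 0.
Proof. by move=> /perfect_poly[X _ ->]; exact: cone0. Qed.

Lemma facets_act s h : h \in unitmx ->
  [set f | is_facet f (glact h @` s)] = [set glact h @` f | f in [set f | is_facet f s]].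
Proof.
move=> uh; apply/seteqP; split=> [f fs|_ [f fs <-]]; last exact: facet_act.
exists (glact (invmx h) @` f); last by rewrite hactVK.
by have := facet_act (unitmxV uh) fs; rewrite hactK.
Qed.

Lemma cobd_form F : is_form F -> is_form (cobd F).
Proof.
move=> [aF eF]; split=> [s _|s h b ps uh bs]; first exact: cobd_alternates.
rewrite /cobd facets_act // fsbig_image => [|f e _ _ fe]; last first.
  by rewrite -(hactK f uh) fe hactK.
apply: eq_fsum => f fs; have [sx nfx] := xget_facet fs.
have pf := perfect_facet ps fs.
set x := xget 0 _ in sx nfx; have bf := lbasisP f.
rewrite (cobd_termE (facet_act uh fs) (aF _ (perfect_act uh pf)) (basis_act uh bs)
  (basis_act uh bf) (x := glact h x)); last 2 first.
- by exists x.
- by move=> [y fy /(glact_inj uh) yx]; apply: nfx; rewrite -yx.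
rewrite -map_rcons (ors_act uh bs) ?eF //; exact: (facet_basis fs).
Qed.

Lemma cobd_cobd_form F s b : is_form F -> perfect_cone s ->
  basis_of (lspan s) b -> cobd (cobd F) s b = 0.
Proof.
move=> [aF _] ps bs; apply: (cobd_cobd (perfect_poly ps) bs) => f h fs hf.
apply: aF; apply: perfect_facet hf; exact: perfect_facet fs.
Qed.

Lemma splits_scalar s M phi v : pres s M -> splits M phi v ->
  exists l : {scalar V}, (forall X, s X -> l X = 0) /\ l (sqform R v) = 1.
Proof.
move=> [Q [m [_ _ _ _ ->]]] [fv fM]; have [l lE] := dot_scalar R phi.
exists l; split=> [X|]; last by rewrite lE fv expr1n.
by apply: zcone_scalar_eq0 => w Mw; rewrite lE fM // expr0n.
Qed.

Lemma glact_fix s h X : (forall Y, s Y -> glact h Y = Y) -> X \in lspan s -> glact h X = X.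
Proof.
move=> hs Xs; have : (lspan s <= fixedSpace (linfun (@glact R g h)))%VS.
  by apply: lspan_subv => Y sY; apply/fixedSpaceP; rewrite lfunE /= hs.
by move/subvP/(_ X Xs)/fixedSpaceP; rewrite lfunE.
Qed.

Lemma pres_fix s M h : pres s M -> (forall w, M w -> h *m w = w) ->
  forall X, s X -> glact h X = X.
Proof.
move=> [Q [m [_ _ _ _ ->]]] hM.
apply: (@cone_min R V _ (fun X => glact h X = X)) => [|Y Z hY hZ|t _ t0 [w Mw <-]].
- exact: linear0.
- by rewrite linearD /= hY hZ.
- by rewrite linearZ /= glact_sqform hM.
Qed.

Lemma image_fix s h : (forall X, s X -> glact h X = X) -> glact h @` s = s.
Proof.
move=> hs; apply/seteqP; split=> [_ [X sX <-]|X sX]; first by rewrite hs.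
by exists X => //; exact: hs.
Qed.

Lemma map_fix s h b : (forall X, s X -> glact h X = X) -> basis_of (lspan s) b ->
  map (glact h) b = b.
Proof.
move=> hs bs; rewrite -[RHS]map_id; apply/seq.eq_in_map => X Xb.
by rewrite (glact_fix hs) // (basis_mem bs).
Qed.

Lemma perfect_infl s M phi v : pres s M -> splits M phi v ->
  perfect_cone (infl s (sqform R v)).
Proof. by move=> pM sp; apply: pres_perfect (pres_infl pM sp). Qed.

Lemma pres_infl_basis s M phi v b : pres s M -> splits M phi v ->
  basis_of (lspan s) b ->
  basis_of (lspan (infl s (sqform R v))) (rcons b (sqform R v)).
Proof.
move=> pM sp bs; have [l [ls lv]] := splits_scalar pM sp.
by apply: (infl_basis _ ls lv bs); exact: perfect0 (pres_perfect pM).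
Qed.

(** The element from [splits_conj] fixes the span of [s] pointwise, so it carries one inflation to
    the other without changing [b]. *)
Lemma form_infl_indep F s M phi psi v w b : is_form F -> pres s M ->
  splits M phi v -> splits M psi w -> basis_of (lspan s) b ->
  F (infl s (sqform R v)) (rcons b (sqform R v)) =
  F (infl s (sqform R w)) (rcons b (sqform R w)).
Proof.
move=> [_ eF] pM sv sw bs; have [h uh [hv hM]] := splits_conj sv sw.
have fixh := pres_fix pM hM.
rewrite -(eF _ h _ (perfect_infl pM sv) uh (pres_infl_basis pM sv bs)).
by rewrite infl_act map_rcons glact_sqform hv (image_fix fixh) (map_fix fixh bs).
Qed.

Definition apex s : 'cV[int]_g :=
  xget 0 [set v | exists M phi, pres s M /\ splits M phi v].

(* The transpose of inflation. *)
Definition coinfl F : cochain := fun s b =>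
  if `[< low_cone s >] then
    F (infl s (sqform R (apex s))) (rcons b (sqform R (apex s))) else 0.

Lemma apexP s M : pres s M -> low_cone s -> exists phi, splits M phi (apex s).
Proof.
move=> pM [N [phi [v [pN sv]]]].
have [N' [psi [pN' sa]]] : [set v | exists M phi, pres s M /\ splits M phi v] (apex s).
  by apply: xgetPex; exists v, N, phi.
by exists psi; rewrite (pres_uniq pM pN').
Qed.

Lemma coinflE F s M phi v b : is_form F -> pres s M -> splits M phi v ->
  basis_of (lspan s) b ->
  coinfl F s b = F (infl s (sqform R v)) (rcons b (sqform R v)).
Proof.
move=> fF pM sv bs; have ls : low_cone s by exists M, phi, v.
rewrite /coinfl asboolT //; have [psi sa] := apexP pM ls.
exact: form_infl_indep fF pM sa sv bs.
Qed.

Lemma low_cone_act s h : h \in unitmx -> low_cone s -> low_cone (glact h @` s).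
Proof.
move=> uh [M [phi [v [pM [fv fM]]]]].
exists [set h *m w | w in M], (phi *m invmx h), (h *m v); split.
  exact: pres_act.
have e w : dot (phi *m invmx h) (h *m w) = dot phi w.
  by rewrite /dot -mulmxA mulKmx.
by split=> [|_ [w Mw <-]]; rewrite e // fM.
Qed.

Lemma ors_infl s M phi v b c : pres s M -> splits M phi v ->
  basis_of (lspan s) b -> basis_of (lspan s) c ->
  ors (rcons b (sqform R v)) (rcons c (sqform R v)) = ors b c.
Proof.
move=> pM sp bs cs; have [l [ls lv]] := splits_scalar pM sp.
have s0 := perfect0 (pres_perfect pM).
apply: (ors_facet (infl_facet_base s0 ls lv) bs cs) => //.
- exact: infl_apex.
- exact: (infl_notin ls lv).
- exact: infl_apex.
- exact: (infl_notin ls lv).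
Qed.

Lemma coinfl_form F : is_form F -> is_form (coinfl F).
Proof.
move=> fF; have [aF eF] := fF; split=> [s ps b c bs cs|s h b ps uh bs].
  have [ls|nls] := pselect (low_cone s); last first.
    by rewrite /coinfl asboolF // mulr0.
  have [M pM] := perfect_pres ps; have [phi sa] := apexP pM ls.
  rewrite !(coinflE fF pM sa) // (aF _ (perfect_infl pM sa) (rcons b (sqform R (apex s)))).
  - by rewrite (ors_infl pM sa).
  - exact: (pres_infl_basis pM sa).
  - exact: (pres_infl_basis pM sa).
have [ls|nls] := pselect (low_cone s); last first.
  rewrite /coinfl !asboolF // => /(low_cone_act (unitmxV uh)).
  by rewrite hactK.
have [M pM] := perfect_pres ps; have [phi [fa fM]] := apexP pM ls.
have sa : splits M phi (apex s) by [].
have e w : dot (phi *m invmx h) (h *m w) = dot phi w by rewrite /dot -mulmxA mulKmx.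
have sha : splits [set h *m w | w in M] (phi *m invmx h) (h *m apex s).
  by split=> [|_ [w Mw <-]]; rewrite e // fM.
rewrite (coinflE fF (pres_act uh pM) sha (basis_act uh bs)) (coinflE fF pM sa bs).
rewrite -glact_sqform -infl_act -map_rcons eF //; first exact: perfect_infl sa.
exact: (pres_infl_basis pM sa).
Qed.

Lemma infl_comm s X Y : infl (infl s X) Y = infl (infl s Y) X.
Proof.
have sub A B : infl (infl s A) B `<=` infl (infl s B) A.
  move=> _ [_ [t [[Z [u [sZ u0 ->]]] t0 ->]]]; rewrite addrAC.
  by exists (Z + t *: B), u; split=> //; exists Z, t.
by apply/seteqP; split.
Qed.

(* Exchanging two coloops reverses orientation. *)
Lemma coinfl_infl F s M phi v b : is_form F -> pres s M -> splits M phi v ->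
  basis_of (lspan (infl s (sqform R v))) b -> coinfl F (infl s (sqform R v)) b = 0.
Proof.
move=> fF pM sv bi; set x := sqform R v; have [aF eF] := fF.
have [li|nli] := pselect (low_cone (infl s x)); last by rewrite /coinfl asboolF.
have pM' := pres_infl pM sv.
have [psi sw] := apexP pM' li; set w := apex _ in sw.
have [fv fM] := sv; have [pw pMv] := sw.
have pv : dot psi v = 0 by apply: pMv; right; left.
(* Correcting [w] by a multiple of [v] makes [v, u] dual to [phi, psi]; the value of [coinfl F] does
   not depend on the complement. *)
pose u := w - dot phi w *: v.
have fu : dot phi u = 0 by rewrite dotDr dotNr dotZr fv mulr1 subrr.
have pu : dot psi u = 1 by rewrite dotDr dotNr dotZr pv mulr0 subr0.
have su : splits (M `|` [set v; - v]) psi u by exact: (conj pu pMv).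
clearbody u; have bs := lbasisP s; set c := lbasis s in bs.
have bx : basis_of (lspan (infl s x)) (rcons c x) by exact: (pres_infl_basis pM sv bs).
have [aC _] := coinfl_form fF.
rewrite (aC _ (pres_perfect pM') (rcons c x) b bx bi).
rewrite (coinflE fF pM' su bx); set y := sqform R u.
(* A quarter turn, [v] to [u] and [u] to [- v]. Since [sqform] ignores signs, it exchanges [x] and
   [y]. *)
have [h uh [hv hu hfix]] := @plane_unit _ phi psi v u 0 1 1 0 fv fu pv pu erefl.
have {}hv : h *m v = u by rewrite hv scale0r add0r scale1r.
have {}hu : h *m u = - v by rewrite hu scale0r addr0 scaleN1r.
have fixh X : s X -> glact h X = X.
  apply: (pres_fix pM) => z Mz; apply: hfix; first exact: fM.
  by apply: pMv; left.
have bxy := pres_infl_basis pM' su bx.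
have xy : glact h x = y by rewrite glact_sqform hv.
have yx : glact h y = x by rewrite glact_sqform hu sqformN.
have pT : perfect_cone (infl (infl s x) y) by exact: (perfect_infl pM' su).
have := eF _ h _ pT uh bxy.
rewrite !infl_act (image_fix fixh) !map_rcons (map_fix fixh bs) xy yx infl_comm => e.
have byx : basis_of (lspan (infl (infl s x) y)) (rcons (rcons c y) x).
  have := basis_act uh bxy.
  by rewrite !infl_act (image_fix fixh) !map_rcons (map_fix fixh bs) xy yx infl_comm.
(* Invariance gives the exchanged basis the same value, alternation the opposite one. *)
have := aF _ pT _ _ bxy byx; rewrite e ors_swap ?(basis_free bxy) // mulN1r => /eqP.
by rewrite -subr_eq0 opprK -mulr2n mulrn_eq0 /= => /eqP->; rewrite mulr0.
Qed.

Lemma facets_infl s M phi v : pres s M -> splits M phi v ->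
  [set e | is_facet e (infl s (sqform R v))] =
  [set s] `|` [set infl f (sqform R v) | f in [set f | is_facet f s]].
Proof.
move=> pM sv; have [l [ls lv]] := splits_scalar pM sv.
have s0 := perfect0 (pres_perfect pM).
apply/seteqP; split=> [e /(infl_facetP s0 ls lv)[->|[f fs ->]]|e [->|[f fs <-]]].
- by left.
- by right; exists f.
- exact: (infl_facet_base s0 ls lv).
- exact: (infl_facet s0 ls lv).
Qed.

Lemma fsum_facets_infl s M phi v (T : set V -> rat) : pres s M -> splits M phi v ->
  \sum_(e \in [set e | is_facet e (infl s (sqform R v))]) T e =
  T s + \sum_(f \in [set f | is_facet f s]) T (infl f (sqform R v)).
Proof.
move=> pM sv; have [l [ls lv]] := splits_scalar pM sv.
have s0 := perfect0 (pres_perfect pM).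
have fin := finite_facets (pres_poly pM).
rewrite (facets_infl pM sv) fsbigU0 ?fsbig_set1; last 3 first.
- exact: finite_set1.
- exact: finite_image.
- move=> _ [-> [f fs fE]]; apply: (infl_notin ls lv (f := s)) => //.
  rewrite -fE; apply: infl_apex; case: fs => fs _; exact: face0 fs s0.
rewrite fsbig_image // => f e /set_mem fs /set_mem es.
exact: (infl_inj ls lv (facet_sub fs) (facet_sub es)).
Qed.

Lemma pres_facet_splits s M f phi v : pres s M -> splits M phi v -> is_facet f s ->
  exists2 N, pres f N & splits N phi v.
Proof.
move=> pM [fv fM] [fs _]; have [N pN NM] := pres_is_face pM fs.
by exists N => //; split=> // w /NM; exact: fM.
Qed.

Lemma homotopy_low F s b : is_form F -> perfect_cone s -> low_cone s ->
  basis_of (lspan s) b ->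
  coinfl (cobd F) s b + cobd (coinfl F) s b = F s b.
Proof.
move=> fF ps [M [phi [v [pM sv]]]] bs; have [aF eF] := fF.
have [l [ls lv]] := splits_scalar pM sv; have s0 := perfect0 ps.
set x := sqform R v in lv *.
have bx : basis_of (lspan (infl s x)) (rcons b x) by exact: (pres_infl_basis pM sv bs).
have ss := infl_facet_base s0 ls lv; have nsx := infl_notin ls lv (@subset_refl _ s).
have ix := infl_apex x s0.
rewrite (coinflE (cobd_form fF) pM sv bs) {1}/cobd (fsum_facets_infl _ pM sv) -/x.
rewrite (cobd_termE ss (aF _ ps) bx bs ix nsx).
rewrite ors_refl ?(basis_free bx) // mul1r -addrA.
rewrite -[RHS]addr0; congr (_ + _); rewrite /cobd -fsbig_split /=; last first.
  exact: finite_facets (pres_poly pM).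
apply: fsbig1 => f fs; have [N pN sN] := pres_facet_splits pM sv fs.
have pf := perfect_facet ps fs; have [y sy nfy] := facet_neq fs.
have fi := infl_facet s0 ls lv fs; have bf := lbasisP f; set c := lbasis f in bf.
have bfx : basis_of (lspan (infl f x)) (rcons c x) by exact: (pres_infl_basis pN sN bf).
(* One [y] serves for [f] in [s] and for [infl f x] in [infl s x]. Both terms are then multiples of
   the same value of [F], with signs that compare the orders [y, x] and [x, y]. *)
have nify : ~ infl f x y.
  by move=> iy; apply: nfy; rewrite (infl_inter ls lv (facet_sub fs)); split=> //; exact: ls.
have iy : infl s x y by exact: infl_sub.
have [aC _] := coinfl_form fF.
rewrite (cobd_termE fi (aF _ (perfect_infl pN sN)) bx bfx iy nify).
rewrite (cobd_termE fs (aC _ pf) bs bf sy nfy) (coinflE fF pN sN bf) -/x -mulrDl.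
have bfy := facet_basis fs sy nfy bf.
have bfyx := facet_basis ss ix nsx bfy; have bfxy := facet_basis fi iy nify bfx.
rewrite -(ors_mul bx bfyx bfxy) ors_swap ?(basis_free bfyx) // mulrN1.
by rewrite (ors_infl pM sv bs bfy) addNr mul0r.
Qed.

(** Here [v] is minimal, since otherwise [s] would be low; [a] is the face on which phi^2
    vanishes. *)
Lemma coloop_cone_infl s : coloop_cone s -> ~ low_cone s ->
  exists a M phi v, [/\ pres a M, splits M phi v & s = infl a (sqform R v)].
Proof.
move=> [M [phi [v [pM fv fM]]]] nls; have [l lE] := dot_scalar R phi.
have [Q [m [_ _ _ _ sE]]] := pM.
have lM w : M w -> 0 <= l (sqform R w) by move=> _; rewrite lE sqr_ge0.
have lge X : s X -> 0 <= l X.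
  by rewrite sE; apply: cone_scalar_ge0 => _ [w Mw <-]; exact: lM.
pose N := [set w | M w /\ l (sqform R w) = 0]; pose a := [set X | s X /\ l X = 0].
have pN : pres a N := pres_face pM lge.
have NE w : N w <-> M w /\ dot phi w = 0.
  rewrite /N /= lE; split=> -[Mw].
    by move/eqP; rewrite sqrf_eq0 intr_eq0 => /eqP.
  by move=> ->; rewrite expr0n.
have sN : splits N phi v by split=> // w /NE[].
exists a, N, phi, v; split=> //.
have Mv : M v.
  apply: contrapT => nMv; apply: nls; exists M, phi, v; split=> //; split=> // w Mw.
  case: (fM w Mw) => // -[] wv; case: nMv; first by rewrite -wv.
  by rewrite -[v]opprK -wv; exact: presN pM Mw.
have -> : a = zcone N by case: pN => ? [? []].
rewrite zcone_infl sE; congr zcone; apply/seteqP; split=> w.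
  move=> Mw; case: (fM w Mw) => [fw|[->|->]].
  - by left; apply/NE.
  - by right; left.
  - by right; right.
by case=> [/NE[]//|[->//|->]]; exact: presN pM Mv.
Qed.

Lemma homotopy F s b : is_form F -> perfect_cone s -> coloop_cone s ->
  basis_of (lspan s) b ->
  coinfl (cobd F) s b + cobd (coinfl F) s b = F s b.
Proof.
move=> fF ps cs bs; have [ls|nls] := pselect (low_cone s).
  exact: homotopy_low.
(* A cone that is not low is itself an inflation of some [a]. Of its facets only [a] contributes,
   because [coinfl F] vanishes on the inflated ones. *)
rewrite {1}/coinfl asboolF // add0r; have [aF _] := fF.
have [a [M [phi [v [pM sv sE]]]]] := coloop_cone_infl cs nls.
rewrite {}sE in ps nls bs *.
have [l [la lv]] := splits_scalar pM sv; have pa := pres_perfect pM.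
have a0 := perfect0 pa.
set x := sqform R v in lv bs nls ps *.
have ba := lbasisP a; set c := lbasis a in ba.
have [aC _] := coinfl_form fF.
have bx : basis_of (lspan (infl a x)) (rcons c x) by exact: (pres_infl_basis pM sv ba).
rewrite /cobd (fsum_facets_infl _ pM sv) -/x.
rewrite (cobd_termE (infl_facet_base a0 la lv) (aC _ pa) bs ba (infl_apex x a0)
  (infl_notin la lv (@subset_refl _ a))).
rewrite (coinflE fF pM sv ba) -/x fsbig1 ?addr0.
  by rewrite (ors_sym bs bx) -(aF _ ps _ _ bx bs).
move=> f fs; have [N pN sN] := pres_facet_splits pM sv fs.
by rewrite /cobd_term (coinfl_infl fF pN sN) ?mulr0 //; exact: lbasisP.
Qed.

End Forms.

(** * Orbits *)

Section OrientationSign.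
Variables (F : realFieldType) (V : vectType F).
Implicit Types (o : set (seq V)) (b c : seq V) (U : {vspace V}).

Definition osg o b : rat := (-1) ^+ (~~ `[< o b >]).

Lemma osg_sqr o b : osg o b * osg o b = 1.
Proof. by rewrite /osg -expr2 sqrr_sign. Qed.

Lemma eq_osg o o' b c : (o b <-> o' c) -> osg o b = osg o' c.
Proof. by move=> e; rewrite /osg (asbool_equiv_eq e). Qed.

Lemma orientationE U o b c : is_orientation U o -> basis_of U b -> basis_of U c ->
  `[< o c >] = (`[< o b >] == same_orientation b c).
Proof.
move=> [_ oP] bU cU; have [e1 e2] := oP b c bU cU.
case: asboolP => oc; case: asboolP => ob; case: same_orientation e1 e2 => //= e1 e2.
- by have := e1 (conj (fun _ => oc) (fun _ => ob)).
- by case: ob; apply/(e2 isT).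
- by case: oc; apply/(e2 isT).
- by have := e1 (conj (fun p => False_ind _ (ob p)) (fun p => False_ind _ (oc p))).
Qed.

Lemma osg_ors U o b c : is_orientation U o -> basis_of U b -> basis_of U c ->
  osg o c = ors b c * osg o b.
Proof.
move=> oU bU cU; rewrite /osg /ors (orientationE oU bU cU).
by case: asboolP => _; case: same_orientation; rewrite /= ?mulr1 ?mul1r ?mulrNN ?mulr1.
Qed.

Lemma orientation_ext U o o' b : is_orientation U o -> is_orientation U o' ->
  basis_of U b -> (o b <-> o' b) -> o = o'.
Proof.
move=> oU oU' bU /asbool_equiv_eq e; apply/seteqP; split=> c oc; apply/asboolP.
  have cU := oU.1 c oc; rewrite (orientationE oU' bU cU) -e -(orientationE oU bU cU).
  exact/asboolP.
have cU := oU'.1 c oc; rewrite (orientationE oU bU cU) e -(orientationE oU' bU cU).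
exact/asboolP.
Qed.

End OrientationSign.

Section Orbits.
Variables (R : realType) (g : nat).
Notation V := 'M[R]_g.
Notation cochain := (set V -> seq V -> rat).
Implicit Types (h k : 'M[int]_g) (s t f : set V) (b c : seq V) (F : cochain).
Implicit Types (o : set (seq V)).

Lemma same_orbit_refl s : same_orbit s s.
Proof. by exists 1%:M; rewrite ?unitmx1 // hact1. Qed.

Lemma same_orbit_sym s t : same_orbit s t -> same_orbit t s.
Proof. by move=> [h uh ->]; exists (invmx h); rewrite ?unitmxV // hactK. Qed.

Lemma same_orbit_trans s t f : same_orbit s t -> same_orbit t f -> same_orbit s f.
Proof.
move=> [h uh ->] [k uk ->]; exists (k *m h); last by rewrite hactM.
by rewrite unitmx_mul uk uh.
Qed.

Lemma same_orbit_act s h : h \in unitmx -> same_orbit s (glact h @` s).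
Proof. by exists h. Qed.

Lemma same_orbit_dim s t : same_orbit s t -> cone_dim s = cone_dim t.
Proof. by move=> [h uh ->]; rewrite cone_dim_act. Qed.

Lemma map_glactK h b : h \in unitmx -> map (glact (invmx h)) (map (@glact R g h) b) = b.
Proof. by move=> uh; rewrite -map_comp -[RHS]map_id; apply: eq_map => X /=; exact: glactK. Qed.

Lemma map_glactVK h b : h \in unitmx -> map (glact h) (map (@glact R g (invmx h)) b) = b.
Proof. by move=> uh; rewrite -map_comp -[RHS]map_id; apply: eq_map => X /=; exact: glactVK. Qed.

Lemma orient_actP h o b : h \in unitmx -> orient_act h o (map (glact h) b) <-> o b.
Proof.
move=> uh; split=> [[c oc e]|ob]; last by exists b.
by rewrite -(map_glactK b uh) -e map_glactK.
Qed.

Lemma orient_actM h k o : orient_act h (orient_act k o) = orient_act (h *m k) o.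
Proof.
have e b : map (@glact R g h) (map (glact k) b) = map (glact (h *m k)) b.
  by rewrite -map_comp; apply: eq_map => X; exact: glactM.
apply/seteqP; split=> [_ [_ [b ob <-] <-]|_ [b ob <-]]; first by exists b.
by exists (map (glact k) b); [exists b|].
Qed.

Lemma orientation_act h s o : h \in unitmx -> is_orientation (lspan s) o ->
  is_orientation (lspan (glact h @` s)) (orient_act h o).
Proof.
move=> uh [oU oP]; split=> [_ [b ob <-]|b c bU cU].
  by apply: basis_act => //; exact: oU.
have bU' := basis_act (unitmxV uh) bU; have cU' := basis_act (unitmxV uh) cU.
rewrite hactK // in bU' cU'.
rewrite -(map_glactVK b uh) -(map_glactVK c uh).
rewrite (same_orientation_map (glact_inj uh) bU' cU').
split=> [[e1 e2]|e].
  by apply/oP => //; split=> /(orient_actP _ _ uh)/[dup] => [/e1|/e2] /(orient_actP _ _ uh).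
by split=> /(orient_actP _ _ uh) ob; apply/(orient_actP _ _ uh);
  apply/(iffRL (oP _ _ bU' cU') e).
Qed.

(** If the value is nonzero, invariance under a stabilizing [h] forces the sign between a basis and
    its image to be 1, so [h] preserves orientation. This lets cochains be expanded in the [orb x],
    which live on alternating cones. *)
Lemma form_nonalternating F s b : is_form F -> perfect_cone s -> ~ alternating s ->
  basis_of (lspan s) b -> F s b = 0.
Proof.
move=> [aF eF] ps nas bs; apply: contrapT => /eqP Fb; apply: nas; split=> // h uh hs o oo.
have key c : basis_of (lspan s) c -> o c <-> o (map (glact h) c).
  move=> cs; have hcs : basis_of (lspan s) (map (glact h) c).
    by rewrite -{1}hs; exact: basis_act.
  apply/(oo.2 _ _ cs hcs).
  have Fc : F s c != 0.
    by rewrite (aF s ps b c bs cs) mulf_neq0 // /ors signr_eq0.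
  have := aF s ps c _ cs hcs; rewrite -{1}hs eF // => /eqP.
  rewrite -{1}[F s c]mul1r (inj_eq (mulIf Fc)) /ors.
  by case: same_orientation.
apply/seteqP; split=> [_ [c oc <-]|c oc]; first by apply/(key c (oo.1 c oc)).
have cs := oo.1 c oc; exists (map (glact (invmx h)) c); last exact: map_glactVK.
apply/key; last by rewrite map_glactVK.
by have := basis_act (unitmxV uh) cs; rewrite -{1}hs hactK.
Qed.

End Orbits.

(** * Chains *)

Section Induced.
Variables (R : realType) (g : nat).
Notation V := 'M[R]_g.
Implicit Types (s f : set V) (b c : seq V) (o : set (seq V)).

Lemma facet_ray_generator s M f : pres s M -> is_facet f s ->
  exists2 X, ray_generator s X & ~ f X.
Proof.
move=> pM fs; apply: contrapT => nX; have [X sX nfX] := facet_neq fs; apply: nfX.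
have [[l [lge fE]] _] := fs; have [Q [m [_ _ _ _ sE]]] := pM.
rewrite fE; split=> //; move: sX; rewrite sE; apply: zcone_scalar_eq0 => v Mv.
have : f (sqform R v).
  by apply: contrapT => nf; apply: nX; exists (sqform R v) => //; exact: pres_ray Mv.
by rewrite fE => -[].
Qed.

Lemma same_orientation_facet s f b c x y : is_facet f s ->
  basis_of (lspan f) b -> basis_of (lspan f) c ->
  s x -> ~ f x -> s y -> ~ f y ->
  same_orientation (rcons b x) (rcons c y) = same_orientation b c.
Proof.
move=> fs bf cf sx nfx sy nfy; have := ors_facet fs bf cf sx nfx sy nfy.
by rewrite /ors; do 2 case: same_orientation.
Qed.

(** A ray generator outside [f] exists, and by [same_orientation_facet] any [y] of [s] outside [f]
    gives the same answer as that generator. *)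
Lemma induced_orientationE s M f o b y : pres s M -> is_facet f s ->
  is_orientation (lspan s) o -> basis_of (lspan f) b -> s y -> ~ f y ->
  induced_orientation f s o b <-> o (rcons b y).
Proof.
move=> pM fs oo bf sy nfy.
have eq x : s x -> ~ f x -> o (rcons b x) <-> o (rcons b y).
  move=> sx nfx; apply/(oo.2 _ _ (facet_basis fs sx nfx bf) (facet_basis fs sy nfy bf)).
  by rewrite (same_orientation_facet fs bf bf) // same_orientation_refl ?(basis_free bf).
split=> [[_ [x [[e [es _ ex _]] nfx ox]]]|oy].
  by apply/(eq x) => //; exact: face_sub es _ ex.
have [x rx nfx] := facet_ray_generator pM fs.
split=> //; exists x; split=> //; apply/(eq x) => //.
by case: rx => e [es _ ex _]; exact: face_sub es _ ex.
Qed.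

Lemma induced_is_orientation s M f o : pres s M -> is_facet f s ->
  is_orientation (lspan s) o -> is_orientation (lspan f) (induced_orientation f s o).
Proof.
move=> pM fs oo; split=> [b []//|b c bf cf].
have [y sy nfy] := facet_neq fs.
have eb := induced_orientationE pM fs oo bf sy nfy.
have ec := induced_orientationE pM fs oo cf sy nfy.
have := oo.2 _ _ (facet_basis fs sy nfy bf) (facet_basis fs sy nfy cf).
rewrite (same_orientation_facet fs bf cf) // => e.
split=> [ibc|so]; first by apply/e; split=> /[dup] ? => [/eb/ibc/ec|/ec/ibc/eb].
by split=> [/eb/(iffRL e so)/ec|/ec/(iffRL e so)/eb].
Qed.

End Induced.

(** * Dual basis cochains, transposition and contraction of chains *)

Section Chains.
Variables (R : realType) (g : nat).
Notation V := 'M[R]_g.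
Notation cochain := (set V -> seq V -> rat).
Variables (G : int -> set (set V)) (om : set V -> set (seq V)).
Hypothesis hG : forall n : int, orbit_representatives (alternating_of_degree n) (G n).
Hypothesis hom : forall (n : int) (s : set V), G n s -> is_orientation (lspan s) (om s).
Implicit Types (h k : 'M[int]_g) (s t x f : set V) (b : seq V) (F : cochain).
Implicit Types (n m : int) (c : set V -> rat) (T : cochain -> cochain).

Let ext := extend_orientation G om.

Lemma G_alternating n t : G n t -> alternating t.
Proof. by move=> Gt; have [[]] := (hG n).1 t Gt. Qed.

Lemma G_perfect n t : G n t -> perfect_cone t.
Proof. by move=> /G_alternating[]. Qed.

Lemma G_dim n t : G n t -> (cone_dim t)%:Z = n + 1.
Proof. by move=> Gt; have [] := (hG n).1 t Gt. Qed.

Lemma G_uniq n m t u : G n t -> G m u -> same_orbit t u -> t = u.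
Proof.
move=> Gt Gu tu; have nm : n = m.
  by apply: (addIr 1); rewrite -(G_dim Gt) -(G_dim Gu) (same_orbit_dim tu).
subst m; have [w [_ wuniq]] := (hG n).2 u ((hG n).1 u Gu).
rewrite -(wuniq t); first by apply: wuniq; split=> //; exact: same_orbit_refl.
by split.
Qed.

(** Two elements carrying [t] to the same cone differ by a stabilizer of [t], which preserves [om t]
    because [t] is alternating. So the union defining [ext] is a single orientation. *)
Lemma ext_orientation n t h : G n t -> h \in unitmx ->
  ext (glact h @` t) = orient_act h (om t).
Proof.
move=> Gt uh; apply/seteqP; split=> b; last by exists n, t, h.
move=> [m [u [k [Gu uk hu ob]]]]; have tu : t = u.
  apply: (G_uniq Gt Gu); apply: same_orbit_trans (same_orbit_act t uh) _.
  by rewrite hu; apply: same_orbit_sym; exact: same_orbit_act.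
subst u; have [_ alt] := G_alternating Gt.
have ut : invmx h *m k \in unitmx by rewrite unitmx_mul unitmxV.
have st : glact (invmx h *m k) @` t = t by rewrite -hactM -hu hactK.
have := alt _ ut st _ (hom Gt); rewrite -orient_actM => e.
by rewrite -e orient_actM mulmxV // orient_actM mul1mx.
Qed.

Lemma ext_is_orientation n t s : G n t -> same_orbit t s -> is_orientation (lspan s) (ext s).
Proof.
move=> Gt [h uh ->]; rewrite (ext_orientation Gt uh).
exact: orientation_act (hom Gt).
Qed.

Lemma ext_rep n s : G n s -> ext s = om s.
Proof.
move=> Gs; have := ext_orientation Gs (unitmx1 _ _); rewrite hact1 => ->.
have e b : map (@glact R g 1%:M) b = b.
  by rewrite -[RHS]map_id; apply: eq_map => X; exact: glact1.
by apply/seteqP; split=> [_ [b ob <-]|b ob]; [rewrite e|exists b].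
Qed.

Lemma ext_act n t s h b : G n t -> same_orbit t s -> h \in unitmx ->
  ext (glact h @` s) (map (glact h) b) <-> ext s b.
Proof.
move=> Gt [k uk ->] uh; rewrite hactM !(ext_orientation Gt) //; last first.
  by rewrite unitmx_mul uh uk.
by rewrite -orient_actM; exact: orient_actP.
Qed.

(** The cochain dual to the basis vector [e_x]. *)
Definition orb x : cochain := fun s b =>
  if `[< same_orbit x s >] then osg (ext s) b else 0.

(** The value of [F] at [s] oriented by [ext s]; by [evE] any other basis gives the same number on
    orbits of representatives where [F] alternates. *)
Definition ev F s : rat := osg (ext s) (lbasis s) * F s (lbasis s).

Lemma orb_form n x : G n x -> is_form (orb x).
Proof.
move=> Gx; split=> [s ps b c bs cs|s h b ps uh bs]; rewrite /orb.
  case: asboolP => xs; last by rewrite mulr0.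
  exact: osg_ors (ext_is_orientation Gx xs) bs cs.
case: (asboolP (same_orbit x s)) => xs.
  rewrite asboolT; last by apply: same_orbit_trans xs _; exact: same_orbit_act.
  by apply: eq_osg; exact: (ext_act _ Gx).
rewrite asboolF // => xhs; apply: xs; apply: same_orbit_trans xhs _.
by apply: same_orbit_sym; exact: same_orbit_act.
Qed.

Lemma evE F n t s b : G n t -> same_orbit t s -> alternates F s ->
  basis_of (lspan s) b -> ev F s = osg (ext s) b * F s b.
Proof.
move=> Gt ts aF bs; have bl := lbasisP s.
rewrite /ev (aF _ _ bl bs) (osg_ors (ext_is_orientation Gt ts) bl bs).
by rewrite mulrACA ors_sqr mul1r.
Qed.

Lemma ev_act F n t h : is_form F -> G n t -> h \in unitmx ->
  ev F (glact h @` t) = ev F t.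
Proof.
move=> [aF eF] Gt uh; have bt := lbasisP t; have pt := G_perfect Gt.
rewrite (evE Gt (same_orbit_act t uh) (aF _ (perfect_act uh pt)) (basis_act uh bt)).
rewrite eF // /ev; congr (_ * _); apply: eq_osg.
exact: (ext_act _ Gt (same_orbit_refl t)).
Qed.

Lemma form_expansion F n s b : is_form F -> perfect_cone s ->
  (cone_dim s)%:Z = n + 1 -> basis_of (lspan s) b ->
  F s b = \sum_(x \in G n) orb x s b * ev F x.
Proof.
move=> fF ps ds bs; have [as_|nas] := pselect (alternating s); last first.
  rewrite (form_nonalternating fF ps nas bs) fsbig1 // => x Gx.
  by rewrite (form_nonalternating (orb_form Gx) ps nas bs) mul0r.
have [t [[Gt ts] _]] := (hG n).2 s (conj as_ ds).
rewrite (fsum_only (i := t)) //; last first.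
  move=> x Gx xt; rewrite /orb asboolF ?mul0r // => xs.
  case/eqP: xt; apply: (G_uniq Gx Gt); apply: same_orbit_trans xs _.
  exact: same_orbit_sym.
rewrite /orb asboolT //; have [h uh sE] := ts.
rewrite -(ev_act fF Gt uh) -sE (evE Gt ts (fF.1 _ ps) bs).
by rewrite mulrA osg_sqr mul1r.
Qed.

(** This makes [boundary] the transpose of [cobd]. Facet by facet, both sides are the sign comparing
    [ext f] with the orientation induced by [om s], tested on one basis of [f]. *)
Lemma delta_ev n x s : G n s -> G (n - 1) x -> delta G om x s = ev (cobd (orb x)) s.
Proof.
move=> Gs Gx; have ps := G_perfect Gs; have [M pM] := perfect_pres ps.
have bs := lbasisP s; set b := lbasis s in bs.
rewrite /delta (@fsum_sub _ _ [set f | is_facet f s]) => [|f []//].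
rewrite /ev /cobd mulr_fsumr; apply: eq_fsum => f fs.
have [sy nfy] := xget_facet fs; rewrite /cobd_term; set y := xget 0 _ in sy nfy *.
have bf := lbasisP f; set c := lbasis f in bf *; rewrite /orb -/b.
case: (asboolP (same_orbit x f)) => xf; last first.
  by rewrite asboolF ?mulr0 // => -[].
rewrite asboolT; last by split.
have oos := hom Gs; rewrite mulrA (ext_rep Gs) [osg _ _ * _]mulrC.
have bfy := facet_basis fs sy nfy bf.
rewrite -(osg_ors oos bs bfy) /Defs.eta -/(ext f).
have oe := ext_is_orientation Gx xf; have oi := induced_is_orientation pM fs oos.
have ie := induced_orientationE pM fs oos bf sy nfy.
have [e|ne] := pselect (ext f c <-> om s (rcons c y)).
  rewrite asboolT; first by rewrite (eq_osg e) osg_sqr.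
  apply: (orientation_ext oe oi bf); split=> [/e/ie|/ie/e]; exact.
rewrite asboolF => [|fe]; last by apply: ne; rewrite fe.
rewrite /osg; case: asboolP => o1; case: asboolP => o2; rewrite /= ?mulr1 ?mul1r //.
  by case: ne.
by case: ne.
Qed.

Definition pairing n F c : rat := \sum_(s \in G n) c s * ev F s.

(** The transpose of [T]: when [T F] in degree [n] depends on [F] in degree [m], chains go from
    degree [n] to degree [m]. *)
Definition adj n m T c : set V -> rat := fun x =>
  if `[< G m x >] then pairing n (T (orb x)) c else 0.

Lemma boundary_adj n c : boundary G om n c = adj n (n - 1) (@cobd R g) c.
Proof.
apply: funext => x; rewrite /boundary /adj /pairing; case: asboolP => // Gx.
by apply: eq_fsum => s Gs; rewrite (delta_ev Gs Gx).
Qed.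

(* T F at (s, b) is a fixed finite combination of values of F in degree m. *)
Definition finitary n m T := forall s b, perfect_cone s ->
  (cone_dim s)%:Z = n + 1 -> basis_of (lspan s) b ->
  exists r : seq (rat * set V * seq V),
    (forall p, p \in r -> [/\ perfect_cone p.1.2, (cone_dim p.1.2)%:Z = m + 1 &
                           basis_of (lspan p.1.2) p.2]) /\
    forall F, is_form F -> T F s b = \sum_(p <- r) p.1.1 * F p.1.2 p.2.

Lemma finite_reps m s : finite_set [set x | G m x /\ same_orbit x s].
Proof.
have [[x [Gx xs]]|nx] := pselect (exists x, G m x /\ same_orbit x s); last first.
  by rewrite (_ : [set x | _] = set0) //; apply/seteqP; split=> // x xP; apply: nx; exists x.
apply: sub_finite_set (finite_set1 x) => y [Gy ys] /=; apply: (G_uniq Gy Gx).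
by apply: same_orbit_trans ys _; exact: same_orbit_sym.
Qed.

Lemma orb_neq0 x s b : orb x s b != 0 -> same_orbit x s.
Proof. by rewrite /orb; case: asboolP => //; rewrite eqxx. Qed.

(** Sums over [G m] default to 0 on infinite supports, so a finite carrier is needed. Each of the
    finitely many [s] with nonzero coefficient involves finitely many cones, each with at most one
    representative. *)
Lemma adj_support n m T c : finitary n m T -> perfect_chains G n c ->
  exists X, [/\ finite_set X, X `<=` G m &
    forall x s, G m x -> c s != 0 -> ev (T (orb x)) s != 0 -> X x].
Proof.
move=> finT [finc cG].
pose Y s := [set x | G m x /\ ev (T (orb x)) s != 0].
exists (\bigcup_(s in [set s | c s != 0]) Y s); split.
- apply: bigcup_finite => // s cs; have Gs := cG s cs.
  have [r [rP rE]] := finT s _ (G_perfect Gs) (G_dim Gs) (lbasisP s).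
  apply: (@sub_finite_set _ _ (\bigcup_(p in [set` r]) [set x | G m x /\ same_orbit x p.1.2])).
    move=> x [Gx]; rewrite /ev rE; last exact: orb_form Gx.
    rewrite mulf_eq0 /osg signr_eq0 /= => nz.
    have [p pr pn] : exists2 p, p \in r & orb x p.1.2 p.2 != 0.
      apply: contrapT => np; case/eqP: nz; rewrite big_seq big1 // => p pr.
      have [->|pn] := eqVneq (orb x p.1.2 p.2) 0; first by rewrite mulr0.
      by case: np; exists p.
    by exists p => //; split=> //; exact: orb_neq0 pn.
  by apply: bigcup_finite => [|p _]; [exact: finite_seq|exact: finite_reps].
- by move=> x [s _ []].
- by move=> x s Gx cs xs; exists s.
Qed.

Lemma pairing_neq0 n F c : pairing n F c != 0 ->
  exists s, [/\ G n s, c s != 0 & ev F s != 0].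
Proof.
move=> pn; apply: contrapT => ns; case/eqP: pn; apply: fsbig1 => s Gs.
have [->|cs] := eqVneq (c s) 0; first by rewrite mul0r.
have [->|es] := eqVneq (ev F s) 0; first by rewrite mulr0.
by case: ns; exists s.
Qed.

Lemma adj_neq0 n m T c x : adj n m T c x != 0 ->
  exists s, [/\ G m x, G n s, c s != 0 & ev (T (orb x)) s != 0].
Proof.
rewrite /adj; case: asboolP => [Gx /pairing_neq0[s [? ? ?]]|_]; first by exists s.
by rewrite eqxx.
Qed.

Lemma adj_chains n m T c : finitary n m T -> perfect_chains G n c ->
  perfect_chains G m (adj n m T c).
Proof.
move=> finT cC; have [X [finX XG XP]] := adj_support finT cC; split.
  apply: sub_finite_set finX => x /adj_neq0[s [Gx Gs cs es]]; exact: XP cs es.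
by move=> x /adj_neq0[s []].
Qed.

(** [ev (T F) s] is a combination of finitely many values of [F], and [form_expansion] writes each
    of them through the dual basis. *)
Lemma pairing_adj n m T F c : finitary n m T -> is_form F -> perfect_chains G n c ->
  pairing m F (adj n m T c) = pairing n (T F) c.
Proof.
move=> finT fF cC; have [X [finX XG XP]] := adj_support finT cC.
have [finc cG] := cC; pose S := [set s | c s != 0].
have suppS F' : pairing n F' c = \sum_(s \in S) c s * ev F' s.
  rewrite /pairing -(fsbig_widen S (G n)) // => s [_ /negP].
  by rewrite /S /= negbK => /eqP ->; rewrite mul0r.
rewrite {1}/pairing -(fsbig_widen X (G m)) //; last first.
  move=> x [Gx nXx] /=; rewrite (_ : adj _ _ _ _ x = 0) ?mul0r //.
  apply/eqP; apply: contrapT => /negP /adj_neq0[s [_ _ cs es]].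
  by apply: nXx; exact: XP cs es.
transitivity (\sum_(x \in X) \sum_(s \in S) c s * ev (T (orb x)) s * ev F x).
  apply: eq_fsum => x Xx; rewrite /adj asboolT ?suppS ?mulr_fsuml //.
  exact: XG.
rewrite exchange_fsbig // suppS; apply: eq_fsum => s cs; have Gs := cG s cs.
under eq_fsbigr do rewrite -mulrA.
rewrite -mulr_fsumr; congr (_ * _).
have [r [rP rE]] := finT s _ (G_perfect Gs) (G_dim Gs) (lbasisP s).
pose Y := \bigcup_(p in [set` r]) [set x | G m x /\ same_orbit x p.1.2].
have finY : finite_set Y.
  by apply: bigcup_finite => [|p _]; [exact: finite_seq|exact: finite_reps].
have YG : Y `<=` G m by move=> x [p _ []].
have orbY x p : p \in r -> G m x -> ~ Y x -> orb x p.1.2 p.2 = 0.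
  move=> pr Gx nYx; apply: contrapT => /eqP /orb_neq0 xp; apply: nYx.
  by exists p.
(* For fixed [s] the sum over [X] is moved to [Y], the representatives of the cones that occur in
   the formula for [T F] at [s]. *)
rewrite (fsbig_widen X (G m)) // => [|x [Gx nXx] /=]; last first.
  have [->|es] := eqVneq (ev (T (orb x)) s) 0; first by rewrite mul0r.
  by case: nXx; exact: XP cs es.
rewrite -(fsbig_widen Y (G m)) // => [|x [Gx nYx] /=]; last first.
  rewrite /ev rE; last exact: orb_form Gx.
  by rewrite big_seq big1 ?mulr0 ?mul0r // => p pr; rewrite orbY ?mulr0.
rewrite [RHS]/ev rE // mulr_sumr.
transitivity (\sum_(x \in Y) \sum_(p <- r)
    osg (ext s) (lbasis s) * (p.1.1 * (orb x p.1.2 p.2 * ev F x))).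
  apply: eq_fsum => x Yx; rewrite /ev rE; last exact: orb_form (YG x Yx).
  rewrite mulr_sumr mulr_suml; apply: eq_bigr => p _.
  by rewrite -!mulrA.
rewrite fsbig_finite //= exchange_big /= big_seq [RHS]big_seq.
apply: eq_bigr => p pr; rewrite -!mulr_sumr; congr (_ * (_ * _)).
have [pp dp bp] := rP p pr; rewrite (form_expansion fF pp dp bp).
rewrite -(fsbig_widen Y (G m)) ?fsbig_finite // => x [Gx nYx] /=.
by rewrite orbY ?mul0r.
Qed.

Lemma cobd_finitary n : finitary n (n - 1) (@cobd R g).
Proof.
move=> s b ps ds bs; have fin := finite_facets (perfect_poly ps).
exists [seq (ors b (rcons (lbasis f) (xget 0 (s `\` f))), f, lbasis f) |
  f <- finmap.enum_fset (fset_set [set f | is_facet f s])]; split=> [p /mapP[f + ->]|F fF] /=.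
  rewrite in_fset_set // => /set_mem fs; split; last exact: lbasisP.
    exact: perfect_facet fs.
  by case: fs => _ df; move: ds; rewrite -df; lia.
by rewrite /cobd fsbig_finite // big_map.
Qed.

Lemma coinfl_finitary n : finitary n (n + 1) (@coinfl R g).
Proof.
move=> s b ps ds bs; have [ls|nls] := pselect (low_cone s); last first.
  by exists [::]; split=> // F fF; rewrite /coinfl asboolF // big_nil.
have [M pM] := perfect_pres ps; have [phi sa] := apexP pM ls.
exists [:: (1, infl s (sqform R (apex s)), rcons b (sqform R (apex s)))].
split=> [p|F fF]; last by rewrite big_seq1 /= mul1r (coinflE fF pM sa).
rewrite inE => /eqP -> /=; split; first exact: (perfect_infl pM sa).
  have [l [la lv]] := splits_scalar pM sa.
  by rewrite (infl_dim (perfect0 ps) la lv) -ds; lia.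
exact: (pres_infl_basis pM sa bs).
Qed.

Lemma pairing_orb n x c : G n x -> pairing n (orb x) c = c x.
Proof.
move=> Gx; rewrite /pairing (fsum_only (i := x)) // => [|s Gs sx].
  by rewrite /ev /orb asboolT ?osg_sqr ?mulr1 //; exact: same_orbit_refl.
rewrite /ev /orb asboolF ?mulr0 // => xs; case/eqP: sx.
by apply/esym; exact: G_uniq Gx Gs xs.
Qed.

Lemma coloop_facet s f : coloop_cone s -> is_facet f s -> coloop_cone f.
Proof.
move=> [M [phi [v [pM fv fM]]]] [fs _]; have [N pN NM] := pres_is_face pM fs.
by exists N, phi, v; split=> // w /NM; exact: fM.
Qed.

Lemma coloop_orbit s t : same_orbit s t -> coloop_cone s -> coloop_cone t.
Proof.
move=> [h uh ->] [M [phi [v [pM fv fM]]]].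
have e w : dot (phi *m invmx h) (h *m w) = dot phi w.
  by rewrite /dot -mulmxA mulKmx.
exists [set h *m w | w in M], (phi *m invmx h), (h *m v); split.
- exact: pres_act.
- by rewrite e.
- move=> _ [w Mw <-]; rewrite e; case: (fM w Mw) => [|[->|->]].
  + by left.
  + by right; left.
  + by right; right; rewrite mulmxN.
Qed.

Lemma coloop_infl s M phi v : pres s M -> splits M phi v ->
  coloop_cone (infl s (sqform R v)).
Proof.
move=> pM sv; have [fv fM] := sv; exists (M `|` [set v; - v]), phi, v.
split=> //; first exact: (pres_infl pM sv).
by move=> w [/fM|[->|->]]; [left|right; left|right; right].
Qed.

Lemma boundary_inflation n c : (0 < g)%N -> inflation_chains G n c ->
  inflation_chains G (n - 1) (boundary G om n c).
Proof.
move=> g0 [cC cI]; split.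
  by rewrite boundary_adj; apply: adj_chains cC; exact: cobd_finitary.
move=> x; rewrite boundary_adj => /adj_neq0[s [Gx Gs cs es]].
have ps := G_perfect Gs; have cls := (inflation_coneP g0 ps).1 (cI s cs).
apply/(inflation_coneP g0 (G_perfect Gx)).
have [f fs xf] : exists2 f, is_facet f s & same_orbit x f.
  apply: contrapT => nf; case/eqP: es; rewrite /ev /cobd fsbig1 ?mulr0 // => f fs.
  rewrite /cobd_term /orb asboolF ?mulr0 // => xf; apply: nf.
  by exists f.
apply: coloop_orbit (same_orbit_sym xf) _; exact: coloop_facet fs.
Qed.

Lemma coinfl_inflation n c : (0 < g)%N -> inflation_chains G n c ->
  inflation_chains G (n + 1) (adj n (n + 1) (@coinfl R g) c).
Proof.
move=> g0 [cC cI]; split; first by apply: adj_chains cC; exact: coinfl_finitary.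
move=> x /adj_neq0[s [Gx Gs cs es]]; have ps := G_perfect Gs.
apply/(inflation_coneP g0 (G_perfect Gx)).
have [ls|nls] := pselect (low_cone s); last first.
  by case/eqP: es; rewrite /ev /coinfl asboolF // mulr0.
have [M pM] := perfect_pres ps; have [phi sa] := apexP pM ls.
apply: (coloop_orbit _ (coloop_infl pM sa)); apply: same_orbit_sym.
move: es; rewrite /ev (coinflE (orb_form Gx) pM sa (lbasisP s)).
by rewrite mulf_eq0 negb_or => /andP[_ /orb_neq0].
Qed.

Lemma boundary_boundary n c : perfect_chains G (n + 1) c ->
  boundary G om n (boundary G om (n + 1) c) = 0.
Proof.
move=> cC; rewrite [in LHS]boundary_adj; apply: funext => x; rewrite /adj.
case: asboolP => // Gx; have fx := orb_form Gx.
have := pairing_adj (@cobd_finitary (n + 1)) (cobd_form fx) cC.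
rewrite boundary_adj addrK => ->; apply: fsbig1 => s Gs.
rewrite /ev (cobd_cobd_form fx (G_perfect Gs) (lbasisP s)).
by rewrite !mulr0.
Qed.

(** Pair [c] with I d + d I applied to [orb x]. The second term is a pairing with the boundary of
    [c], which is 0; the first is the wanted coefficient at [x]. The identity I d + d I = 1 is
    applied on the support of [c], where all cones are inflation cones. *)
Lemma boundary_coinfl n c : (0 < g)%N -> inflation_chains G n c ->
  boundary G om n c = 0 -> boundary G om (n + 1) (adj n (n + 1) (@coinfl R g) c) = c.
Proof.
move=> g0 [cC cI] c0; rewrite boundary_adj addrK; apply: funext => x; rewrite {1}/adj.
case: asboolP => [Gx|nGx]; last first.
  by apply: contrapT => /nesym/eqP cx; apply: nGx; apply: cC.2.
have fx := orb_form Gx.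
rewrite (pairing_adj (@coinfl_finitary n) (cobd_form fx) cC).
have := pairing_adj (@cobd_finitary n) (coinfl_form fx) cC.
rewrite -boundary_adj c0 => e.
have {}e : pairing n (cobd (coinfl (orb x))) c = 0.
  by rewrite -e /pairing fsbig1 // => s _; rewrite mul0r.
rewrite -[LHS]addr0 -e -(pairing_orb c Gx) /pairing.
have [finc cG] := cC; pose S := [set s | c s != 0].
have suppS F' : pairing n F' c = \sum_(s \in S) c s * ev F' s.
  rewrite /pairing -(fsbig_widen S (G n)) // => s [_ /negP].
  by rewrite /S /= negbK => /eqP ->; rewrite mul0r.
rewrite -!/(pairing _ _ _) !suppS -fsbig_split //=.
apply: eq_fsum => s cs; have Gs := cG s cs; have ps := G_perfect Gs.
have cls := (inflation_coneP g0 ps).1 (cI s cs).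
by rewrite -mulrDr /ev -mulrDr (homotopy fx ps cls (lbasisP s)).
Qed.

End Chains.

Theorem theorem5p15 (R : realType) (g : nat) (hg : (1 <= g)%N)
  (G : int -> set (set 'M[R]_g)) (om : set 'M[R]_g -> set (seq 'M[R]_g))
  (hG : forall n : int, orbit_representatives (alternating_of_degree n) (G n))
  (hom : forall (n : int) (s : set 'M[R]_g), G n s -> is_orientation (lspan s) (om s))
  (n : int) :
  [set c | inflation_chains G n c /\ boundary G om n c = 0] =
  [set boundary G om (n + 1) b | b in inflation_chains G (n + 1)].
Proof.
apply/seteqP; split=> [c [cI c0]|_ [b bI <-]] /=.
  exists (adj G om n (n + 1) (@coinfl R g) c); first exact: coinfl_inflation.
  exact: boundary_coinfl.
split; last exact: (boundary_boundary hG hom bI.1).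
by have := boundary_inflation hG hom hg bI; rewrite addrK.
Qed.
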